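(* For any closed conic set $\Gamma\subseteq\mathbb{R}^{2d}\setminus\{0\}$ (closed in $\mathbb{R}^{2d}\setminus\{0\}$) there exists $u\in\mathscr{S}'(\mathbb{R}^d)$ such that $\mathrm{WF}_G(u)=\Gamma$.
   Context: Conic means invariant under multiplication by positive reals. Notation: $(\cdot,\cdot)$ denotes the action of $\mathscr{S}'(\mathbb{R}^d)$ on $\mathscr{S}(\mathbb{R}^d)$, conjugate linear in the test function; $\langle z\rangle=(1+|z|^2)^{1/2}$; $T_x\varphi(y)=\varphi(y-x)$, $M_\xi\varphi(y)=e^{iy\cdot\xi}\varphi(y)$. The short-time Fourier transform of $u\in\mathscr{S}'(\mathbb{R}^d)$ with window $\varphi\in\mathscr{S}(\mathbb{R}^d)\setminus\{0\}$ is $V_\varphi u(x,\xi)=(u,M_\xi T_x\varphi)$, $(x,\xi)\in\mathbb{R}^{2d}$. The Gabor wave front set $\mathrm{WF}_G(u)\subseteq\mathbb{R}^{2d}\setminus\{0\}$ is defined by its complement: $z_0\in\mathbb{R}^{2d}\setminus\{0\}$ is not in $\mathrm{WF}_G(u)$ if for one (equivalently, as is known, for all) $\varphi\in\mathscr{S}(\mathbb{R}^d)\setminus\{0\}$ there is an open cone $\Gamma_0\subseteq\mathbb{R}^{2d}\setminus\{0\}$ containing $z_0$ such that $\sup_{z\in\Gamma_0}\langle z\rangle^N|V_\varphi u(z)|<\infty$ for all $N\ge0$. *)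

(* Defs.v *)
From HB Require Import structures.
From mathcomp Require Import all_boot all_order all_algebra.
From mathcomp Require Import complex.
From mathcomp Require Import all_classical all_reals all_analysis.

Set Implicit Arguments.
Unset Strict Implicit.
Unset Printing Implicit Defensive.

Import Order.TTheory GRing.Theory Num.Theory.
Import numFieldNormedType.Exports.

Local Open Scope classical_set_scope.
Local Open Scope ring_scope.

Section Euclidean.
Context {R : realType} {d : nat}.

Definition dotr (x y : 'rV[R]_d) : R := \sum_(i < d) x 0 i * y 0 i.

(* The library norm on row vectors is the sup norm, hence the explicit
   Euclidean expressions here. *)
Definition jbracket (x : 'rV[R]_d) : R := Num.sqrt (1 + dotr x x).

(* R^{2d} is represented as R^d x R^d, with its product topology. *)
Definition jbracket2 (z : 'rV[R]_d * 'rV[R]_d) : R :=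
  Num.sqrt (1 + (dotr z.1 z.1 + dotr z.2 z.2)).

End Euclidean.

Section Schwartz.
Context {R : realType} {d : nat}.
Implicit Types (f g phi : 'rV[R]_d -> R[i]) (x y xi : 'rV[R]_d).

Definition cdifferentiable f x : Prop :=
  differentiable (fun y => complex.Re (f y)) x /\
  differentiable (fun y => complex.Im (f y)) x.

Definition cpartial (i : 'I_d) f : 'rV[R]_d -> R[i] := fun x =>
  ('D_(delta_mx 0 i) (fun y => complex.Re (f y)) x
   +i* 'D_(delta_mx 0 i) (fun y => complex.Im (f y)) x)%C.

(* A multi-index derivative is encoded by the sequence of the coordinates to
   differentiate in; the order of differentiation is its size. *)
Definition cpartials (s : seq 'I_d) f : 'rV[R]_d -> R[i] := foldr cpartial f s.

Definition csmooth f : Prop := forall s x, cdifferentiable (cpartials s f) x.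

Definition schwartz_range (k : nat) (s : seq 'I_d) f : set R :=
  [set jbracket x ^+ k * Normc.normc (cpartials s f x) | x in [set: 'rV[R]_d]].

Definition schwartz f : Prop :=
  csmooth f /\ forall k s, has_ubound (schwartz_range k s f).

(* Meaningful on Schwartz functions only: an unbounded set has sup 0. *)
Definition schwartz_seminorm (k : nat) (s : seq 'I_d) f : R :=
  sup (schwartz_range k s f).

(* An element of S'(R^d) is a function u on all maps R^d -> C of which only the
   values on Schwartz functions matter; u f stands for (u, f).  The second
   clause is continuity for the locally convex topology of S(R^d). *)
Definition tempered (u : ('rV[R]_d -> R[i]) -> R[i]) : Prop :=
  (forall (a : R[i]) f g, schwartz f -> schwartz g ->
     u (fun x => a * f x + g x) = (a^*)%C * u f + u g) /\
  (forall f (e : R), schwartz f -> 0 < e ->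
     exists (N : nat) (delta : R), 0 < delta /\
       forall g, schwartz g ->
         (forall k s, (k <= N)%N -> (size s <= N)%N ->
            schwartz_seminorm k s (fun x => g x - f x) < delta) ->
         Normc.normc (u g - u f) < e).

End Schwartz.

Section Gabor.
Context {R : realType} {d : nat}.
Implicit Types (phi : 'rV[R]_d -> R[i]) (u : ('rV[R]_d -> R[i]) -> R[i]).

Definition translation (x : 'rV[R]_d) phi : 'rV[R]_d -> R[i] :=
  fun y => phi (y - x).

Definition modulation (xi : 'rV[R]_d) phi : 'rV[R]_d -> R[i] :=
  fun y => (cos (dotr y xi) +i* sin (dotr y xi))%C * phi y.

Definition stft phi u (z : 'rV[R]_d * 'rV[R]_d) : R[i] :=
  u (modulation z.2 (translation z.1 phi)).

Definition conic (A : set ('rV[R]_d * 'rV[R]_d)) : Prop :=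
  forall (t : R) z, 0 < t -> A z -> A (t *: z).

Definition open_cone (A : set ('rV[R]_d * 'rV[R]_d)) : Prop :=
  [/\ open A, conic A & A `<=` [set~ 0]].

Definition gabor_regular u (z0 : 'rV[R]_d * 'rV[R]_d) : Prop :=
  exists phi, [/\ schwartz phi, phi <> (fun=> 0) &
    exists Gamma0, [/\ open_cone Gamma0, Gamma0 z0 &
      forall N : nat, has_ubound
        [set jbracket2 z ^+ N * Normc.normc (stft phi u z) | z in Gamma0]]].

Definition WF_G u : set ('rV[R]_d * 'rV[R]_d) :=
  [set z | z <> 0 /\ ~ gabor_regular u z].

End Gabor.

(* Main.v *)
Require Import Defs.
From HB Require Import structures.
From mathcomp Require Import all_boot all_order all_algebra.
From mathcomp Require Import complex.
From mathcomp Require Import all_classical all_reals all_analysis.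
From mathcomp Require Import ring lra.

Set Implicit Arguments.
Unset Strict Implicit.
Unset Printing Implicit Defensive.

Import Order.TTheory GRing.Theory Num.Theory.
Import numFieldNormedType.Exports.

Local Open Scope classical_set_scope.
Local Open Scope ring_scope.

(* The distribution u is a sum of Gaussian wave packets centred at points zeta_k of
   Gamma with |zeta_k| = 4^k, whose directions come infinitely often close to
   every direction of Gamma, the k-th packet having width eps_k = 2^-k in position.
   The short-time Fourier transform of the k-th packet at z is
   O((eps_k |z - zeta_k|)^-N) for every N.  Off a conic neighbourhood of Gamma,
   |z - zeta_k| dominates both |z| and 4^k, so the sum decays rapidly.  Near
   zeta_k, at zeta_k - (y0, 0), the other packets contribute O(2^-k) while the
   k-th one tends in modulus to |phi y0| because eps_k -> 0; hence no window phi
   sees decay along Gamma.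

   Integration over R^d enters only as a Gaussian mean, obtained as an ultrafilter
   limit of means over a random walk with m signs per coordinate and step m^(-1/2).
   Flipping one sign gives Stein's identity E[y_i F] = E[d_i F], which plays the
   role of integration by parts. *)

(** * Limits along a free ultrafilter on the natural numbers *)

Section UltraLimit.
Context {R : realType}.
Implicit Types (a b : nat -> R) (c l C : R).

(** A point counts as regular as soon as one window works. A Gaussian window therefore suffices off
    Gamma, but on Gamma every Schwartz window has to fail. With packets of one fixed shape, the
    transform near zeta_k would look like the transform of that shape, and a point where it does not
    vanish would have to be found for each window. Shrinking packets act in the limit as evaluation
    at a point, up to a phase, so any y0 with phi y0 <> 0 serves.

    The widths must not shrink too fast: a packet of width eps sees a frequency difference only
    through eps times it, so eps_k |zeta_k| must still grow. The choice eps_k = |zeta_k|^(-1/2)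
    reconciles both demands, eps_k |zeta_k| being 2^k.

    Of the Gaussian mean only four properties are used: linearity, its value on constants, a bound
    for functions dominated by [weight], and Stein's identity. Each survives passage to an
    ultrafilter limit of walk means, so the limit need not be identified. *)

Definition seq_bounded a : Prop := exists C, forall n, `|a n| <= C.

Definition free_ultrafilter : set_system nat :=
  sval (cid (ultraFilterLemma (F := \oo) _)).

Local Notation U := free_ultrafilter.

Lemma free_ultrafilter_ultra : UltraFilter U.
Proof. by rewrite /free_ultrafilter; case: cid => ? []. Qed.

Lemma free_ultrafilter_near (P : set nat) : \oo P -> U P.
Proof. by rewrite /free_ultrafilter; case: cid => ? [? /= h]; exact: h. Qed.

Local Instance free_ultrafilter_proper : ProperFilter U :=
  @ultra_proper _ _ free_ultrafilter_ultra.

(** Compactness of [-C, C] gives a cluster point p. An ultrafilter contains the preimage of each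
    neighbourhood of p or of its complement, and the latter would contradict clustering. *)
Lemma cvg_ultra a : seq_bounded a -> cvg (a @ U).
Proof.
move=> [C aC]; have UC : (a @ U) `[- C, C]%classic.
  apply: (filterE (F := U)) => n /=; rewrite in_itv/= -ler_norml; exact: aC.
have [p [_ clp]] := segment_compact _ UC; apply/cvg_ex; exists p => B Bp.
have [//|h] := in_ultra_setVsetC (a @^-1` B) free_ultrafilter_ultra.
by have [x []] := clp (~` B) B h Bp.
Qed.

Definition ulim a : R := lim (a @ U).

Lemma seq_bounded_lin c a b : seq_bounded a -> seq_bounded b ->
  seq_bounded (fun n => c * a n + b n).
Proof.
move=> [A hA] [B hB]; exists (`|c| * A + B) => n.
by rewrite (le_trans (ler_normD _ _))// lerD// normrM ler_wpM2l.
Qed.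

Lemma ulim_lin c a b : seq_bounded a -> seq_bounded b ->
  ulim (fun n => c * a n + b n) = c * ulim a + ulim b.
Proof.
move=> /cvg_ultra ca /cvg_ultra cb; apply: cvg_lim => //.
by apply: cvgD => //; apply: cvgMr.
Qed.

Lemma ulim_cst c : ulim (fun=> c) = c.
Proof. by apply: cvg_lim => //; exact: cvg_cst. Qed.

Lemma ulim_le N C a : seq_bounded a ->
  (forall n, (N <= n)%N -> `|a n| <= C) -> `|ulim a| <= C.
Proof.
move=> /cvg_ultra ca h.
have nN : \oo [set n | (N <= n)%N] by exists N.
rewrite ler_norml; apply/andP; split.
  apply: limr_ge => //; apply: filterS (free_ultrafilter_near nN) => n /= /h.
  by rewrite ler_norml => /andP[].
apply: limr_le => //; apply: filterS (free_ultrafilter_near nN) => n /= /h.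
by rewrite ler_norml => /andP[].
Qed.

End UltraLimit.

(** * Directional derivatives along lines and a first order Taylor bound *)

Section Directional.
Context {R : realType} {V : normedModType R}.
Implicit Types (f g : V -> R) (x v : V).

(** Both difference quotients are the same function of h, because (h + t) v + x = h v + (t v + x).
    This reduces directional derivatives to calculus in one real variable. *)
Lemma is_derive_lineE f x v (t d : R) :
  is_derive t 1 (fun h : R => f (h *: v + x)) d <-> is_derive (t *: v + x) v f d.
Proof.
have E : (fun h : R => h^-1 *: (((fun h0 : R => f (h0 *: v + x)) \o shift t) (h *: 1) -
      f (t *: v + x))) =
   (fun h : R => h^-1 *: ((f \o shift (t *: v + x)) (h *: v) - f (t *: v + x))).
  by apply/funext => h /=; rewrite [h *: 1]mulr1 scalerDl addrA.
by split=> -[]; rewrite /derivable /derive => D1 D2;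
  apply: DeriveDef; rewrite /derivable /derive; move: D1 D2; rewrite E.
Qed.

Lemma is_derive_line0 f x v (d : R) :
  is_derive (0 : R) 1 (fun h : R => f (h *: v + x)) d <-> is_derive x v f d.
Proof. by rewrite is_derive_lineE scale0r add0r. Qed.

Lemma is_derive_postcomp (h : R -> R) f x v (df dg : R) :
  is_derive x v f df -> is_derive (f x) 1 h dg ->
  is_derive x v (h \o f) (dg * df).
Proof.
move=> /is_derive_line0 Df Dg; apply/is_derive_line0.
have Dg' : is_derive ((fun t : R => f (t *: v + x)) 0) 1 h dg.
  by rewrite scale0r add0r.
have := @is_derive1_comp R h (fun t : R => f (t *: v + x)) 0 dg df Dg' Df.
exact.
Qed.

Lemma is_derive_affine f (x w v : V) (e df : R) :
  is_derive (w + e *: x) v f df ->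
  is_derive x v (fun y => f (w + e *: y)) (e * df).
Proof.
move=> /is_derive_line0 Df; apply/is_derive_line0.
have Dm : is_derive (0 : R) 1 (fun h : R => e * h) e.
  by apply: is_derive_eq; rewrite [_ *: _]mulr1.
have Df' : is_derive ((fun h : R => e * h) 0) 1
   (fun h : R => f (h *: v + (w + e *: x))) df by rewrite mulr0.
have := @is_derive1_comp R _ (fun h : R => e * h) 0 _ _ Df' Dm.
rewrite mulrC; congr (is_derive _ _ _ _); apply/funext => h /=.
by rewrite scalerDr scalerA addrCA.
Qed.

Lemma is_derive_lin (c : R) f g (df dg : R) x v :
  is_derive x v f df -> is_derive x v g dg ->
  is_derive x v (fun y => c * f y + g y) (c * df + dg).
Proof. by move=> Df Dg; exact: is_deriveD (is_deriveZ c Df) Dg. Qed.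

End Directional.

(** Two applications of the mean value theorem turn the remainder into T c g2(b) with |b| <= |c| <=
    |T|. The factor 1/2 of Lagrange's form is lost, which is harmless. *)
Lemma taylor1_bound (R : realType) (g g1 g2 : R -> R) (M T : R) :
  (forall t : R, is_derive t 1 g (g1 t)) ->
  (forall t : R, is_derive t 1 g1 (g2 t)) ->
  (forall t, `|t| <= `|T| -> `|g2 t| <= M) ->
  `|g T - g 0 - T * g1 0| <= T ^+ 2 * M.
Proof.
move=> Dg Dg1 hM.
have M0 : 0 <= M by rewrite (le_trans _ (hM 0 _))// normr0.
have mvt (f df : R -> R) (s : R) : (forall t : R, is_derive t 1 f (df t)) ->
    exists2 c, `|c| <= `|s| & f s - f 0 = df c * s.
  move=> Df.
  have cf (a b : R) : {within `[a, b], continuous f}.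
    apply: continuous_subspaceT => y; apply: differentiable_continuous.
    by apply/derivable1_diffP; case: (Df y).
  have [s0|s0] := leP 0 s.
    have [c] := MVT_segment s0 (fun x _ => Df x) (cf 0 s).
    rewrite in_itv/= => /andP[c0 cs] E; exists c; last by rewrite E subr0.
    by rewrite !ger0_norm.
  have [c] := MVT_segment (ltW s0) (fun x _ => Df x) (cf s 0).
  rewrite in_itv/= => /andP[sc c0] E; exists c.
    by rewrite !ler0_norm ?lerN2// ltW.
  by rewrite -opprB E sub0r mulrN opprK.
have [c cT ->] := mvt g g1 T Dg.
rewrite (mulrC T) -mulrBl normrM.
have [b bc ->] := mvt g1 g2 c Dg1.
have -> : T ^+ 2 = `|T| * `|T| by rewrite -normrM -expr2 ger0_norm ?sqr_ge0.
rewrite !normrM -mulrA mulrC ler_pM// ?ler_wpM2r// hM//.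
exact: le_trans cT.
Qed.

Lemma exprn_le_expR (R : realType) (t : R) n : 0 <= t -> t ^+ n <= n`!%:R * expR t.
Proof.
case: n => [|n] t0; first by rewrite expr0 mul1r -expR0 ler_expR.
rewrite mulrC -ler_pdivrMr ?ltr0n ?fact_gt0//.
by apply: le_trans (expR_ge1Dxn n t0); rewrite lerDr.
Qed.

(** * The random walk and its exponential moments *)

Section RandomWalk.
Context {R : realType} {d : nat}.
Implicit Types (m : nat) (f g F : 'rV[R]_d -> R) (y : 'rV[R]_d) (i : 'I_d).

(** At least two signs per coordinate make [step m ^+ 2] at most 1/2, as [cosh_step_le] requires. *)
Definition signs m := {ffun 'I_d -> {ffun 'I_m.+2 -> bool}}.

Definition step m : R := (Num.sqrt m.+2%:R)^-1.

Definition walk m (s : signs m) : 'rV[R]_d :=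
  \row_i (step m * \sum_a (-1) ^+ s i a).

Definition walk_mean m f : R := #|signs m|%:R^-1 * \sum_(s : signs m) f (walk s).

(* Dominates every polynomial, while its mean over the walk is bounded. *)
Definition weight y : R := \prod_i (expR (y 0 i) + expR (- y 0 i)).

(** An upper bound for the mean of [weight], uniform in m. With h = [step m], each coordinate
    contributes 2 (cosh h)^(m+2), at most 2 exp(2/(m+2))^(m+2) = 2 exp 2. *)
Definition weight_mean : R := (2 * expR 2) ^+ d.

Lemma step_gt0 m : 0 < step m.
Proof. by rewrite invr_gt0 sqrtr_gt0 ltr0n. Qed.

Lemma step_sqr m : step m ^+ 2 = m.+2%:R^-1.
Proof. by rewrite exprVn sqr_sqrtr. Qed.

Lemma step_le1 m : step m <= 1.
Proof.
rewrite invf_le1 ?sqrtr_gt0 ?ltr0n// -[leLHS](@sqrtr1 R) ler_sqrt ?ltr0n//.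
by rewrite ler1n.
Qed.

Lemma step_near0 (e : R) : 0 < e -> exists N, forall m, (N <= m)%N -> step m <= e.
Proof.
move=> e0; have := archi_boundP (ltW (exprn_gt0 2 (divr_gt0 ltr01 e0))).
set N := Num.bound _ => hN; exists N => m Nm.
rewrite -(@ler_pXn2r _ 2)// ?nnegrE ?(ltW (step_gt0 _)) ?(ltW e0)// step_sqr.
rewrite -[leRHS]invrK lef_pV2 ?posrE ?invr_gt0 ?exprn_gt0// ?ltr0n//.
rewrite -exprVn -div1r (le_trans (ltW hN))// ler_nat.
exact: leq_trans Nm (leqW (leqnSn _)).
Qed.

Lemma card_signs_gt0 m : (0 : R) < #|signs m|%:R.
Proof. by rewrite ltr0n; apply/card_gt0P; exists [ffun=> [ffun=> true]]. Qed.

Lemma walk_mean_lin m (c : R) f g :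
  walk_mean m (fun y => c * f y + g y) = c * walk_mean m f + walk_mean m g.
Proof. by rewrite /walk_mean big_split/= mulrDr -mulr_sumr mulrCA. Qed.

Lemma walk_mean_cst m (c : R) : walk_mean m (fun=> c) = c.
Proof.
rewrite /walk_mean sumr_const -[c *+ _]mulr_natl mulKf//.
by rewrite gt_eqF ?card_signs_gt0.
Qed.

Lemma walk_mean_norm m f g : (forall y, `|f y| <= g y) ->
  `|walk_mean m f| <= walk_mean m g.
Proof.
move=> fg; rewrite normrM ger0_norm ?invr_ge0 ?(ltW (card_signs_gt0 _))//.
rewrite ler_wpM2l ?invr_ge0 ?(ltW (card_signs_gt0 _))//.
by rewrite (le_trans (ler_norm_sum _ _ _))// ler_sum.
Qed.

Lemma weight_ge0 y : 0 <= weight y.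
Proof. by apply: prodr_ge0 => i _; rewrite addr_ge0 ?expR_ge0. Qed.

Lemma cosh_factor_ge1 (t : R) : 1 <= expR t + expR (- t).
Proof. by have := expR_ge1Dx t; have := expR_ge1Dx (- t); lra. Qed.

Lemma weight_ge1 y : 1 <= weight y.
Proof.
rewrite /weight; elim/big_ind : _ => // [a b a1 b1|i _].
  by rewrite -[1]mulr1 ler_pM.
exact: cosh_factor_ge1.
Qed.

Lemma weight_ge_expR y i : expR `|y 0 i| <= weight y.
Proof.
rewrite /weight (bigD1 i)//= -[leLHS]mulr1 ler_pM ?expR_ge0//.
  case: (ger0P (y 0 i)) => _.
    by rewrite lerDl expR_ge0.
  by rewrite lerDr expR_ge0.
elim/big_ind : _ => // [a b a1 b1|j _].
  by rewrite -[1]mulr1 ler_pM.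
exact: cosh_factor_ge1.
Qed.

Lemma coord_exp_le_weight y i l : `|y 0 i| ^+ l <= l`!%:R * weight y.
Proof.
rewrite (le_trans (exprn_le_expR l (normr_ge0 _)))// ler_wpM2l//.
exact: weight_ge_expR.
Qed.

Lemma weight_shift_le y i (t : R) :
  weight (t *: delta_mx 0 i + y) <= expR `|t| * weight y.
Proof.
rewrite /weight (bigD1 i)//= [in leRHS](bigD1 i)//= mulrA.
set p := \prod_(j < d | j != i) _; set q := \prod_(j < d | j != i) _.
have -> : p = q.
  apply: eq_bigr => j ji; rewrite !mxE eqxx/= (negbTE ji).
  by rewrite mulr0 add0r.
rewrite ler_wpM2r//.
  by apply: prodr_ge0 => j _; rewrite addr_ge0 ?expR_ge0.
rewrite !mxE !eqxx/= mulr1 mulrDr -!expRD lerD// ler_expR.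
  by rewrite lerD2r ler_norm.
by rewrite opprD lerD2r -normrN ler_norm.
Qed.

(** From exp(-h) >= 1 - h and exp h >= 1 + h, the left side is at most 1/(1-h) + 1/(1+h) =
    2/(1-h^2). This is at most 2 (1 + 2 h^2) because h^2 <= 1/2. *)
Lemma cosh_step_le m : expR (step m) + expR (- step m) <= 2 * expR (2 / m.+2%:R).
Proof.
set h := step m.
have h2 : h ^+ 2 <= 2^-1.
  by rewrite step_sqr lef_pV2 ?posrE ?ltr0n// ler_nat.
have h0 : 0 < h := step_gt0 m.
have h1 : h < 1 by rewrite -(@ltr_pXn2r _ 2) ?nnegrE// ?(ltW h0)// expr1n; lra.
have e1 : expR h <= (1 - h)^-1.
  rewrite -[h in leLHS]opprK expRN lef_pV2 ?posrE ?expR_gt0 ?subr_gt0//.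
  exact: expR_ge1Dx.
have e2 : expR (- h) <= (1 + h)^-1.
  rewrite expRN lef_pV2 ?posrE ?expR_gt0 ?addr_gt0//.
  exact: expR_ge1Dx.
apply: le_trans (_ : 2 * (1 + 2 * h ^+ 2) <= _); last first.
  by rewrite ler_pM2l// -step_sqr expR_ge1Dx.
apply: le_trans (lerD e1 e2) _.
have -> : (1 - h)^-1 + (1 + h)^-1 = 2 / (1 - h ^+ 2).
  by field; apply/and3P; split; nra.
rewrite ler_pdivrMr; nra.
Qed.

Lemma weight_walk_mean_le m : walk_mean m weight <= weight_mean.
Proof.
rewrite /walk_mean ler_pdivrMl ?card_signs_gt0//.
pose w (tau : {ffun 'I_m.+2 -> bool}) : R :=
  expR (step m * \sum_a (-1) ^+ tau a) + expR (- (step m * \sum_a (-1) ^+ tau a)).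
(* Independence of the coordinates, as distributivity of product over sum; [W] then uses
   independence of the signs within one coordinate in the same way. *)
have -> : \sum_(s : signs m) weight (walk s) =
    \prod_(i < d) \sum_(tau : {ffun 'I_m.+2 -> bool}) w tau.
  rewrite bigA_distr_bigA; apply: eq_bigr => s _.
  by apply: eq_bigr => i _; rewrite mxE.
have W (h : R) : \sum_(tau : {ffun 'I_m.+2 -> bool}) expR (h * \sum_a (-1) ^+ tau a) =
    (expR h + expR (- h)) ^+ m.+2.
  have -> : (expR h + expR (- h)) ^+ m.+2 =
      \prod_(a < m.+2) \sum_(b : bool) expR (h * (-1) ^+ b).
    rewrite -[in LHS](card_ord m.+2) -prodr_const; apply: eq_bigr => a _.
    by rewrite big_bool/= expr1 expr0 mulrN1 mulr1 addrC.
  rewrite bigA_distr_bigA; apply: eq_bigr => tau _.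
  by rewrite mulr_sumr expR_sum.
have -> : \sum_(tau : {ffun 'I_m.+2 -> bool}) w tau =
    2 * (expR (step m) + expR (- step m)) ^+ m.+2.
  rewrite /w big_split/= W.
  under [X in _ + X]eq_bigr do rewrite -mulNr.
  by rewrite W opprK (addrC (expR (- _))) mulr2n mulrDl mul1r.
rewrite prodr_const card_ord /weight_mean card_ffun card_ord.
rewrite card_ffun card_ord card_bool natrX -exprMn.
have c0 : 0 <= (expR (step m) + expR (- step m)) ^+ m.+2.
  by apply: exprn_ge0; rewrite addr_ge0 ?expR_ge0.
apply: lerXn2r; rewrite ?nnegrE; first exact: mulr_ge0.
  by rewrite mulr_ge0 ?mulr_ge0 ?expR_ge0.
rewrite [leRHS]mulrCA ler_pM2l// natrX.
apply: le_trans (_ : (2 * expR (2 / m.+2%:R)) ^+ m.+2 <= _).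
  by rewrite lerXn2r ?nnegrE ?mulr_ge0 ?addr_ge0 ?expR_ge0// cosh_step_le.
rewrite exprMn ler_wpM2l// -expRM_natl mulrCA divff ?mulr1//.
Qed.

End RandomWalk.

(** * Stein's identity for the walk, with an error term *)

Section Stein.
Context {R : realType} {d : nat}.
Implicit Types (m : nat) (f g F : 'rV[R]_d -> R) (y : 'rV[R]_d) (i : 'I_d).

Local Notation e i := (delta_mx 0 i : 'rV[R]_d).

Definition flip m i (a : 'I_m.+2) (s : @signs d m) : @signs d m :=
  [ffun j => if j == i then [ffun b => (b == a) (+) s j b] else s j].

Lemma flipK m i (a : 'I_m.+2) : involutive (flip i a).
Proof.
move=> s; apply/ffunP => j; rewrite !ffunE.
case: eqP => // _; apply/ffunP => b; rewrite !ffunE.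
by rewrite addbA addbb addFb.
Qed.

Lemma flip_sign m i (a : 'I_m.+2) (s : @signs d m) :
  (-1 : R) ^+ flip i a s i a = - (-1) ^+ s i a.
Proof. by rewrite !ffunE eqxx ffunE eqxx signr_addb expr1 mulN1r. Qed.

Lemma walk_flip m i (a : 'I_m.+2) (s : @signs d m) :
  @walk R d m (flip i a s) = (- 2 * @step R m * (-1) ^+ s i a) *: e i + walk s.
Proof.
apply/rowP => j; rewrite !mxE eqxx/=.
have [->|ji] := eqVneq j i; last first.
  by rewrite mulr0 add0r ffunE (negbTE ji).
rewrite mulr1 (bigD1 a)//= flip_sign [in RHS](bigD1 a)//= !mulrDr addrA.
congr (_ + _ * _); last first.
  by apply: eq_bigr => b ba; rewrite !ffunE eqxx ffunE (negbTE ba) addFb.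
by rewrite -mulrDl; ring.
Qed.

Definition dominated f := exists C, forall y, `|f y| <= C * weight y.

(* Flip one sign of the walk: this changes the weight s of a term into -s and
   moves the walk by -2 h s along e_i, so that Taylor's formula applies. *)
Lemma walk_mean_sign m i (a : 'I_m.+2) F F1 F2 (C : R) :
  (forall y, is_derive y (e i) F (F1 y)) ->
  (forall y, is_derive y (e i) F1 (F2 y)) ->
  (forall y, `|F2 y| <= C * weight y) ->
  `|#|@signs d m|%:R^-1 * (\sum_(s : @signs d m) (-1) ^+ s i a * F (walk s))
     - @step R m * walk_mean m F1|
    <= 2 * @step R m ^+ 2 * (C * expR 2 * @weight_mean R d).
Proof.
move=> DF DF1 hF2; set h := @step R m; set n := #|@signs d m|%:R.
have h0 : 0 < h := step_gt0 m.
have n0 : 0 < n := card_signs_gt0 m.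
have C0 : 0 <= C.
  have := le_trans (normr_ge0 _) (hF2 0).
  by rewrite pmulr_lge0// (lt_le_trans ltr01 (weight_ge1 _)).
(* Each term is averaged with its image under the involution [flip i a], which reverses the sign
   factor and so produces a difference of values of [F]. *)
have -> : n^-1 * (\sum_(s : @signs d m) (-1) ^+ s i a * F (walk s))
     - h * walk_mean m F1 =
  n^-1 * \sum_(s : @signs d m) (2^-1 * (-1) ^+ s i a * (F (walk s) -
    F (walk (flip i a s))) - h * F1 (walk s)).
  rewrite /walk_mean -/n (mulrCA h) -mulrBr; congr (_ * _).
  rewrite sumrB -mulr_sumr; congr (_ - _).
  under [RHS]eq_bigr do rewrite mulrBr.
  rewrite sumrB [X in _ - X](reindex_inj (inv_inj (@flipK m i a)))/=.
  under [X in _ - X]eq_bigr do rewrite flipK flip_sign.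
  rewrite -sumrB; apply: eq_bigr => s _; by field.
rewrite normrM ger0_norm ?invr_ge0 ?(ltW n0)//.
apply: le_trans (_ : n^-1 * \sum_(s : @signs d m)
    (2 * h ^+ 2 * (C * expR 2)) * weight (walk s) <= _); last first.
  rewrite -mulr_sumr mulrCA -!mulrA !ler_wpM2l ?exprn_ge0 ?expR_ge0 ?(ltW h0)//.
  exact: weight_walk_mean_le.
rewrite ler_wpM2l ?invr_ge0 ?(ltW n0)// (le_trans (ler_norm_sum _ _ _))//.
apply: ler_sum => s _; rewrite walk_flip -/h.
set sg := (-1) ^+ _; set T := - 2 * _ * _; set y := walk s.
have sg2 : sg * sg = 1 by rewrite -expr2 sqrr_sign.
have nT : `|T| = 2 * h.
  by rewrite !normrM normrN normr_nat normr_sign mulr1 gtr0_norm.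
have T2 : T ^+ 2 = 4 * h ^+ 2 
  by transitivity (4 * h ^+ 2 * (sg * sg)); [rewrite /T; ring|rewrite sg2 mulr1].
have Dl (G G1 : 'rV[R]_d -> R) : (forall y, is_derive y (e i) G (G1 y)) ->
    forall t : R, is_derive t 1 (fun t => G (t *: e i + y)) (G1 (t *: e i + y)).
  by move=> DG t; apply/is_derive_lineE; exact: DG.
(* The segment has length 2h <= 2, so [weight] grows along it by a factor of at most [expR 2]. *)
have hM (t : R) : `|t| <= `|T| ->
    `|F2 (t *: e i + y)| <= C * expR 2 * weight y.
  rewrite nT => tT; rewrite (le_trans (hF2 _))// -mulrA ler_wpM2l//.
  rewrite (le_trans (weight_shift_le _ _ _))// ler_wpM2r ?weight_ge0//.
  rewrite ler_expR (le_trans tT)// -[leRHS]mulr1 ler_pM2l//.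
  exact: step_le1.
have := taylor1_bound (Dl _ _ DF) (Dl _ _ DF1) hM.
rewrite scale0r add0r T2 => tay.
have -> : 2^-1 * sg * (F y - F (T *: e i + y)) - h * F1 y =
    - (2^-1 * sg) * (F (T *: e i + y) - F y - T * F1 y).
  transitivity (2^-1 * sg * (F y - F (T *: e i + y)) - h * F1 y * (sg * sg)).
    by rewrite sg2 mulr1.
  by move: (F (T *: _ + _)) => F'; rewrite /T; field.
rewrite normrM normrN normrM normr_sign mulr1 ger0_norm// ler_pdivrMl//.
by rewrite (le_trans tay)//; lra.
Qed.

(** The coordinate [y 0 i] is h = [step m] times a sum of m + 2 signs. By [walk_mean_sign] each sign
    yields h times the mean of [F1], up to O(h^2). Since (m + 2) h^2 = 1, the main terms add up to
    that mean and the errors to O(h). *)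
Lemma walk_mean_stein m i F F1 F2 (C : R) :
  (forall y, is_derive y (e i) F (F1 y)) ->
  (forall y, is_derive y (e i) F1 (F2 y)) ->
  (forall y, `|F2 y| <= C * weight y) ->
  `|walk_mean m (fun y => y 0 i * F y) - walk_mean m F1| <=
    @step R m * (2 * (C * expR 2 * @weight_mean R d)).
Proof.
move=> DF DF1 hF2; set h := @step R m; pose n : R := #|@signs d m|%:R.
have h0 : 0 < h := step_gt0 m.
have -> : walk_mean m (fun y => y 0 i * F y) - walk_mean m F1 =
  h * \sum_(a < m.+2) (n^-1 * (\sum_(s : @signs d m) (-1) ^+ s i a * F (walk s))
     - h * walk_mean m F1).
  rewrite sumrB mulrBr; congr (_ - _); last first.
    rewrite sumr_const card_ord -[_ *+ _]mulr_natl mulrCA mulrA -!mulrA.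
    by rewrite [h * (h * _)]mulrA -expr2 step_sqr mulVKf// pnatr_eq0.
  rewrite -mulr_sumr mulrCA; congr (_ * _).
  rewrite exchange_big/= mulr_sumr; apply: eq_bigr => s _.
  by rewrite mxE -mulrA mulr_suml.
rewrite normrM gtr0_norm// ler_pM2l// (le_trans (ler_norm_sum _ _ _))//.
apply: le_trans (_ : \sum_(a < m.+2) 2 * h ^+ 2 * (C * expR 2 * @weight_mean R d) <= _).
  by apply: ler_sum => a _; exact: (walk_mean_sign a DF DF1 hF2).
rewrite sumr_const card_ord step_sqr -[_ *+ _]mulr_natl.
rewrite mulrA [_ * (2 * _)]mulrCA divff ?pnatr_eq0// mulr1.
by rewrite le_eqVlt eqxx.
Qed.

End Stein.

(** * The Gaussian mean and oscillating integrands *)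

Section GaussianMean.
Context {R : realType} {d : nat}.
Implicit Types (m : nat) (f g F : 'rV[R]_d -> R) (y w eta : 'rV[R]_d) (i : 'I_d).

Local Notation e i := (delta_mx 0 i : 'rV[R]_d).

(* By the central limit theorem this is the mean against the standard Gaussian;
   the ultrafilter spares the proof of convergence. *)
Definition gmean f : R := ulim (fun m => walk_mean m f).

Lemma walk_mean_le m f (C : R) : (forall y, `|f y| <= C * weight y) ->
  `|walk_mean m f| <= C * @weight_mean R d.
Proof.
move=> fC; rewrite (le_trans (walk_mean_norm m fC))//.
have C0 : 0 <= C.
  have := le_trans (normr_ge0 _) (fC 0).
  by rewrite pmulr_lge0// (lt_le_trans ltr01 (weight_ge1 _)).
have -> : walk_mean m (fun y : 'rV[R]_d => C * weight y) = C * walk_mean m (@weight R d).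
  by rewrite /walk_mean -mulr_sumr mulrCA.
by rewrite ler_wpM2l// weight_walk_mean_le.
Qed.

Lemma seq_bounded_walk_mean f : dominated f -> seq_bounded (fun m => walk_mean m f).
Proof.
by move=> [C fC]; exists (C * @weight_mean R d) => m; exact: walk_mean_le.
Qed.

Lemma gmean_le f (C : R) : (forall y, `|f y| <= C * weight y) ->
  `|gmean f| <= C * @weight_mean R d.
Proof.
move=> fC; apply: (@ulim_le R 0); first by apply: seq_bounded_walk_mean; exists C.
by move=> m _; exact: walk_mean_le.
Qed.

Lemma gmean_lin (c : R) f g : dominated f -> dominated g ->
  gmean (fun y => c * f y + g y) = c * gmean f + gmean g.
Proof.
move=> df dg; rewrite /gmean -ulim_lin; try exact: seq_bounded_walk_mean.
by congr ulim; apply/funext => m; exact: walk_mean_lin.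
Qed.

Lemma gmean_cst (c : R) : gmean (fun=> c) = c.
Proof.
rewrite /gmean -[RHS]ulim_cst; congr ulim.
by apply/funext => m; exact: walk_mean_cst.
Qed.

Lemma dominated_lin (c : R) f g : dominated f -> dominated g ->
  dominated (fun y => c * f y + g y).
Proof.
move=> [A hA] [B hB]; exists (`|c| * A + B) => y.
rewrite (le_trans (ler_normD _ _))// mulrDl lerD// normrM -mulrA.
by rewrite ler_wpM2l.
Qed.

Lemma gmean_stein i F F1 F2 :
  (forall y, is_derive y (e i) F (F1 y)) ->
  (forall y, is_derive y (e i) F1 (F2 y)) ->
  dominated (fun y => y 0 i * F y) -> dominated F1 -> dominated F2 ->
  gmean (fun y => y 0 i * F y) = gmean F1.
Proof.
move=> DF DF1 hyF hF1 [C hF2].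
set K := 2 * (C * expR 2 * @weight_mean R d).
have hyF' := seq_bounded_walk_mean hyF; have hF1' := seq_bounded_walk_mean hF1.
have small (r : R) : 0 < r ->
    `|gmean (fun y => y 0 i * F y) - gmean F1| <= r.
  move=> r0.
  (* Only a positive [K] allows the threshold r / K for the step; otherwise the error bound is
     already nonpositive. *)
  have [K0|K0] := leP K 0.
    rewrite /gmean -mulN1r addrC -ulim_lin//.
    apply: (@ulim_le R 0); first exact: seq_bounded_lin.
    move=> m _; rewrite mulN1r addrC.
    rewrite (le_trans (walk_mean_stein m DF DF1 hF2))//.
    by rewrite (le_trans _ (ltW r0))// mulr_ge0_le0// ltW// step_gt0.
  have [N hN] := step_near0 (divr_gt0 r0 K0).
  rewrite /gmean -mulN1r addrC -ulim_lin//.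
  apply: (@ulim_le R N); first exact: seq_bounded_lin.
  move=> m Nm; rewrite mulN1r addrC.
  rewrite (le_trans (walk_mean_stein m DF DF1 hF2))//.
  by rewrite -ler_pdivlMr// hN.
apply/eqP; rewrite -subr_eq0 -normr_le0; apply/ler_addgt0Pr => r r0.
by rewrite add0r small.
Qed.

(** The phase [th] covers cosines as well, by a shift of pi / 2. The power of [y 0 i] is there so
    that multiplication by this coordinate and differentiation along it stay within linear
    combinations of waves. *)
Definition wave eta (th : R) i (l : nat) w (ep : R) f : 'rV[R]_d -> R :=
  fun y => sin (dotr eta y + th) * y 0 i ^+ l * f (w + ep *: y).

Lemma dotr_line eta i (h : R) y : dotr eta (h *: e i + y) = h * eta 0 i + dotr eta y.
Proof.
rewrite /dotr (bigD1 i)//= [in RHS](bigD1 i)//= !mxE !eqxx/= mulr1 mulrDr -addrA.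
congr (_ + (_ + _)); first by rewrite mulrC.
by apply: eq_bigr => j ji; rewrite !mxE (negbTE ji) andbF mulr0 add0r.
Qed.

Lemma is_derive_dotr eta i y : is_derive y (e i) (dotr eta) (eta 0 i).
Proof.
apply/is_derive_line0; under eq_fun do rewrite dotr_line.
by apply: is_derive_eq; rewrite scale0r addr0 add0r [_ *: _]mulr1.
Qed.

Lemma is_derive_coord i y : is_derive y (e i) (fun y => y 0 i) 1.
Proof.
apply/is_derive_line0; under eq_fun do rewrite !mxE !eqxx/= mulr1.
by apply: is_derive_eq; rewrite addr0.
Qed.

(** Product rule. For l = 0 the middle term vanishes through [l%:R], whatever [l.-1] means there. *)
Lemma is_derive_wave eta th i l w ep f f1 y :
  (forall y, is_derive y (e i) f (f1 y)) ->
  is_derive y (e i) (wave eta th i l w ep f)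
   (eta 0 i * wave eta (th + pi / 2) i l w ep f y +
    (l%:R * wave eta th i l.-1 w ep f y + ep * wave eta th i l w ep f1 y)).
Proof.
move=> Df.
have D1 : is_derive y (e i) (fun y => sin (dotr eta y + th))
    (cos (dotr eta y + th) * eta 0 i).
  apply: (@is_derive_postcomp _ _ sin (fun y => dotr eta y + th)).
  apply: is_derive_eq; first exact: is_deriveD (is_derive_dotr _ _ _) (is_derive_cst _ _ _).
  by rewrite addr0.
have D2 := is_deriveX l (is_derive_coord i y).
have D3 := is_derive_affine (Df (w + ep *: y)).
have := is_deriveM (is_deriveM D1 D2) D3.
rewrite (_ : (_ * _ * _)%R = wave eta th i l w ep f); last first.
  by apply/funext => z; rewrite /wave /= exprfctE.
move=> H; apply: is_derive_eq; rewrite /wave (addrA (dotr eta y) th) sinDpihalf exprfctE.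
rewrite mulrfctE /GRing.scale/=; ring.
Qed.

End GaussianMean.

(** * Rapid decay in the frequency *)

Section WaveDecay.
Context {R : realType} {d : nat}.
Implicit Types (f g F : 'rV[R]_d -> R) (y w eta : 'rV[R]_d) (i : 'I_d).

Local Notation e i := (delta_mx 0 i : 'rV[R]_d).

Lemma wave_le eta th i l w (ep : R) f (B : R) : (forall y, `|f y| <= B) ->
  forall y, `|wave eta th i l w ep f y| <= (B * l`!%:R) * weight y.
Proof.
move=> fB y; rewrite /wave !normrM mulrC -mulrA ler_pM ?mulr_ge0// normrX.
rewrite -[leRHS]mul1r ler_pM ?exprn_ge0 ?coord_exp_le_weight//.
by rewrite ler_norml sin_le1 sin_geN1.
Qed.

Lemma dominated_wave eta th i l w (ep : R) f : (exists B, forall y, `|f y| <= B) ->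
  dominated (wave eta th i l w ep f).
Proof. by move=> [B fB]; exists (B * l`!%:R); exact: wave_le. Qed.

Lemma dominated_scale (c : R) f : dominated f -> dominated (fun y => c * f y).
Proof.
by move=> [C hC]; exists (`|c| * C) => y; rewrite normrM -mulrA ler_wpM2l.
Qed.

Lemma gmean_scale (c : R) f : dominated f -> gmean (fun y => c * f y) = c * gmean f.
Proof.
move=> df; have d0 : dominated (fun=> 0 : R).
  by exists 0 => y; rewrite normr0 mul0r.
rewrite -[RHS]addr0 -[X in _ + X](@gmean_cst R d) -gmean_lin//.
by congr gmean; apply/funext => y; rewrite addr0.
Qed.

(** The sequence of iterated derivatives of [p 0%N] along one axis. The whole sequence is carried
    because the induction in [wave_decay] passes from p to its shift. *)
Definition derivative_family i (p : nat -> 'rV[R]_d -> R) : Prop :=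
  (forall j y, is_derive y (e i) (p j) (p j.+1 y)) /\
  (forall j, exists B, forall y, `|p j y| <= B).

Lemma wave_stein i p eta th l w (ep : R) : derivative_family i p ->
  gmean (wave eta th i l.+1 w ep (p 0%N)) =
  eta 0 i * gmean (wave eta (th + pi / 2) i l w ep (p 0%N)) +
  (l%:R * gmean (wave eta th i l.-1 w ep (p 0%N)) +
   ep * gmean (wave eta th i l w ep (p 1%N))).
Proof.
move=> [Dp Bp].
pose DA (th : R) (l j : nat) : 'rV[R]_d -> R := fun y =>
  eta 0 i * wave eta (th + pi / 2) i l w ep (p j) y +
  (l%:R * wave eta th i l.-1 w ep (p j) y + (ep * wave eta th i l w ep (p j.+1) y)).
have DE (t : R) k j y : is_derive y (e i) (wave eta t i k w ep (p j)) (DA t k j y).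
  exact: is_derive_wave (Dp j).
have dA (t : R) k j : dominated (wave eta t i k w ep (p j)) by exact: dominated_wave.
have dDA (t : R) k j : dominated (DA t k j).
  by apply: dominated_lin => //; apply: dominated_lin => //; exact: dominated_scale.
transitivity (gmean (fun y => y 0 i * wave eta th i l w ep (p 0%N) y)).
  by congr gmean; apply/funext => y; rewrite /wave exprS; ring.
have dY : dominated (fun y => y 0 i * wave eta th i l w ep (p 0%N) y).
  have [C hC] := dA th l.+1 0%N; exists C => y.
  by rewrite (le_trans _ (hC y))// /wave exprS le_eqVlt; apply/orP; left;
    apply/eqP; congr `|_|; ring.
have D2 y : is_derive y (e i) (DA th l 0%N)
    (eta 0 i * DA (th + pi / 2) l 0%N y + (l%:R * DA th l.-1 0%N y +
      (ep * DA th l 1%N y))).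
  have D3 := is_deriveZ ep (DE th l 1%N y).
  exact: is_derive_lin (DE _ _ _ y) (is_derive_lin _ (DE _ _ _ y) D3).
rewrite (@gmean_stein _ _ i _ _ _ (DE th l 0%N) D2)//; last first.
  by apply: dominated_lin => //; apply: dominated_lin => //; exact: dominated_scale.
rewrite /DA !gmean_lin//; try (apply: dominated_lin => //); try exact: dominated_scale.
congr (_ + (_ + _)).
exact: gmean_scale.
Qed.

(** Stein's identity solved for its frequency term: one factor [eta 0 i] is traded for a power of
    the coordinate more, a power less, or a derivative of p with the factor ep <= 1. Hence the
    induction on N for all l and p, with [K] independent of p, of the phase and of [ep]. *)
Lemma wave_decay i (N l : nat) : exists2 K : R, 0 <= K &
  forall p, derivative_family i p -> forall B : R,
    (forall j y, (j <= N)%N -> `|p j y| <= B) ->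
  forall eta th w (ep : R), 0 <= ep <= 1 ->
    `|eta 0 i| ^+ N * `|gmean (wave eta th i l w ep (p 0%N))| <= K * B.
Proof.
elim: N l => [|N IH] l.
  exists (l`!%:R * @weight_mean R d).
    by rewrite mulr_ge0// exprn_ge0// mulr_ge0// expR_ge0.
  move=> p _ B pB eta th w ep _; rewrite expr0 mul1r.
  have := gmean_le (wave_le eta th i l w ep (fun y => pB 0%N y isT)).
  by rewrite -mulrA [leRHS]mulrC.
have [K1 K10 h1] := IH l.+1; have [K2 K20 h2] := IH l.-1; have [K3 K30 h3] := IH l.
exists (K1 + l%:R * K2 + K3); first by rewrite !addr_ge0// mulr_ge0.
move=> p hp B pB eta th w ep ep01.
have hp' : derivative_family i (fun j => p j.+1).
  by case: hp => Dp Bp; split=> [j y|j]; [exact: Dp|exact: Bp].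
have pB0 j y : (j <= N)%N -> `|p j y| <= B by move=> jN; rewrite pB// leqW.
have pB1 j y : (j <= N)%N -> `|p j.+1 y| <= B by move=> jN; rewrite pB.
(* The phase is moved back by pi / 2 beforehand, so that the term with the factor [eta 0 i] has
   phase [th]. *)
have := wave_stein eta (th - pi / 2) l w ep hp; rewrite subrK.
set X1 := gmean _; set X := gmean _; set X2 := gmean _; set X3 := gmean _ => E.
have b1 := h1 p hp B pB0 eta (th - pi / 2) w ep ep01.
have b2 := h2 p hp B pB0 eta (th - pi / 2) w ep ep01.
have b3 := h3 _ hp' B pB1 eta (th - pi / 2) w ep ep01.
have {}E : eta 0 i * X = X1 - l%:R * X2 - ep * X3 by rewrite E; ring.
rewrite exprSr -mulrA -normrM E.
have n0 : 0 <= `|eta 0 i| ^+ N by rewrite exprn_ge0.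
have : `|X1 - l%:R * X2 - ep * X3| <= `|X1| + l%:R * `|X2| + `|X3|.
  rewrite (le_trans (ler_normB _ _))// lerD//.
    by rewrite (le_trans (ler_normB _ _))// lerD2l normrM normr_nat.
  rewrite normrM -[leRHS]mul1r ler_wpM2r//.
  by case/andP: ep01 => e0 e1; rewrite ger0_norm.
move=> /(ler_wpM2l n0) h; apply: le_trans h _.
rewrite !mulrDr !mulrDl lerD// lerD//.
by rewrite mulrCA -mulrA ler_wpM2l.
Qed.

End WaveDecay.

(** * Elementary inequalities for powers, moduli and norms *)

Lemma exprD_le (R : realDomainType) (a b : R) n : 0 <= a -> 0 <= b ->
  (a + b) ^+ n <= 2 ^+ n * (a ^+ n + b ^+ n).
Proof.
wlog ab : a b / a <= b => [th|] a0 b0.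
  have [ab|/ltW ba] := leP a b; first exact: th.
  by rewrite addrC [X in _ * X]addrC th.
apply: le_trans (_ : (2 * b) ^+ n <= _).
  by rewrite lerXn2r ?nnegrE ?addr_ge0 ?mulr_ge0// mulr2n mulrDl mul1r lerD2r.
by rewrite exprMn ler_wpM2l ?exprn_ge0// lerDr exprn_ge0.
Qed.

Section ComplexNorm.
Context {R : realType}.
Implicit Types z : R[i].

Lemma normc_ge0 z : 0 <= Normc.normc z.
Proof. by case: z => a b; exact: sqrtr_ge0. Qed.

Lemma Re_le_normc z : `|complex.Re z| <= Normc.normc z.
Proof.
case: z => a b /=; rewrite -sqrtr_sqr ler_wsqrtr//.
by rewrite lerDl sqr_ge0.
Qed.

Lemma Im_le_normc z : `|complex.Im z| <= Normc.normc z.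
Proof.
case: z => a b /=; rewrite -sqrtr_sqr ler_wsqrtr//.
by rewrite lerDr sqr_ge0.
Qed.

Lemma normc_le_ReIm z : Normc.normc z <= `|complex.Re z| + `|complex.Im z|.
Proof.
case: z => a b /=; rewrite -[leRHS]ger0_norm ?addr_ge0// -sqrtr_sqr ler_wsqrtr//.
rewrite sqrrD !real_normK ?num_real// -addrA lerD2l lerDr.
by rewrite mulrn_wge0// mulr_ge0.
Qed.

End ComplexNorm.

Section EuclideanNorms.
Context {R : realType} {d : nat}.
Implicit Types (v x : 'rV[R]_d).

(** The first alternative covers d = 0, where no coordinate exists. *)
Lemma rV_norm_attained v : `|v| = 0 \/ exists i, `|v| = `|v 0 i|.
Proof.
have -> : `|v| = mx_norm v by [].
have [/eqP E|] := boolP (mx_norm v == 0); first by left.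
move/mx_norm_neq0 => [[i j] E]; right; exists j.
by rewrite -[`|v 0 j|]/(`|v 0 j|) E (ord1 i).
Qed.

Lemma coord_le_norm v i : `|v 0 i| <= `|v|.
Proof.
have -> : `|v| = mx_norm v by [].
by rewrite mx_normrE; exact: (@le_bigmax _ _ _ _ (fun ij => `|v ij.1 ij.2|) (0, i)).
Qed.

Lemma dotr_ge0 x : 0 <= dotr x x.
Proof. by apply: sumr_ge0 => i _; rewrite -expr2 sqr_ge0. Qed.

Lemma jbracket_ge1 x : 1 <= jbracket x.
Proof. by rewrite -[leLHS](@sqrtr1 R) ler_wsqrtr// lerDl dotr_ge0. Qed.

Lemma coord_le_jbracket x i : `|x 0 i| <= jbracket x.
Proof.
rewrite -sqrtr_sqr ler_wsqrtr// /dotr (bigD1 i)//= -expr2 addrCA lerDl.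
rewrite addr_ge0//; apply: sumr_ge0 => j _; rewrite -expr2; exact: sqr_ge0.
Qed.

End EuclideanNorms.

(** * Decay of a single wave packet in phase space *)

Section Packet.
Context {R : realType} {d : nat}.
Implicit Types (y w eta : 'rV[R]_d) (i : 'I_d) (f phi : 'rV[R]_d -> R[i]).
Implicit Types (z : 'rV[R]_d * 'rV[R]_d) (th ep : R).

(* The Gaussian mean of exp(i(eta.y + th)) conj(f(w + ep y)). *)
Definition wave_pairing eta th w ep f : R[i] :=
  (gmean (fun y => cos (dotr eta y + th) * complex.Re (f (w + ep *: y)) +
                   sin (dotr eta y + th) * complex.Im (f (w + ep *: y)))
   +i* gmean (fun y => sin (dotr eta y + th) * complex.Re (f (w + ep *: y)) -
                   cos (dotr eta y + th) * complex.Im (f (w + ep *: y))))%C.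

(* Up to a constant, pairing with a Gaussian of width ep centred at the point z
   of phase space. *)
Definition packet z ep f : R[i] := wave_pairing (ep *: z.2) 0 z.1 ep f.

Lemma dotrDr (x y1 y2 : 'rV[R]_d) : dotr x (y1 + y2) = dotr x y1 + dotr x y2.
Proof. by rewrite -big_split; apply: eq_bigr => i _; rewrite mxE mulrDr. Qed.

Lemma dotrZr (x y : 'rV[R]_d) (c : R) : dotr x (c *: y) = c * dotr x y.
Proof. by rewrite mulr_sumr; apply: eq_bigr => i _; rewrite mxE mulrCA. Qed.

Lemma dotrC (x y : 'rV[R]_d) : dotr x y = dotr y x.
Proof. by apply: eq_bigr => i _; rewrite mulrC. Qed.

(** Covariance under phase space shifts: subtracting the phase of the modulation at the point z'.1 +
    ep y from that of the packet leaves only z' - z, apart from a constant phase. *)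
Lemma packet_modulation_translation z' z ep phi :
  packet z' ep (modulation z.2 (translation z.1 phi)) =
  wave_pairing (ep *: (z'.2 - z.2)) (- dotr z'.1 z.2) (z'.1 - z.1) ep phi.
Proof.
rewrite /packet /wave_pairing.
have shift y : z'.1 + ep *: y - z.1 = z'.1 - z.1 + ep *: y by rewrite addrAC.
have phase y : dotr (ep *: (z'.2 - z.2)) y + - dotr z'.1 z.2 =
    dotr (ep *: z'.2) y - dotr (z'.1 + ep *: y) z.2.
  rewrite ![dotr _ y]dotrC !dotrZr dotrDr -[- z.2]scaleN1r dotrZr.
  by rewrite [dotr (_ + _) _]dotrC dotrDr dotrZr [dotr z.2 y]dotrC [dotr z.2 _]dotrC; ring.
congr (_ +i* _)%C; congr gmean; apply/funext => y;
  rewrite /modulation /translation shift phase addr0;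
  case: (phi _) => p q; set al := dotr (_ + _) _; set be := dotr _ y => /=;
  rewrite ?cosB ?sinB; ring.
Qed.

Lemma jet_derivative_family i phi : schwartz phi ->
  derivative_family i (fun j y => complex.Re (cpartials (nseq j i) phi y)) /\
  derivative_family i (fun j y => complex.Im (cpartials (nseq j i) phi y)).
Proof.
move=> [smooth bnd]; split; split=> j.
- move=> y; have [h _] := smooth (nseq j i) y.
  by have := derivableP (@diff_derivable _ _ _ _ _ (delta_mx 0 i) h).
- have [B hB] := bnd 0%N (nseq j i); exists B => y.
  apply: le_trans (Re_le_normc _) _; apply: hB; exists y => //.
  by rewrite expr0 mul1r.
- move=> y; have [_ h] := smooth (nseq j i) y.
  by have := derivableP (@diff_derivable _ _ _ _ _ (delta_mx 0 i) h).
- have [B hB] := bnd 0%N (nseq j i); exists B => y.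
  apply: le_trans (Im_le_normc _) _; apply: hB; exists y => //.
  by rewrite expr0 mul1r.
Qed.

Lemma cos_sin_lin_le (a b c s t : R) :
  `|c| <= 1 -> `|s| <= 1 -> `|a| <= t -> `|b| <= t -> `|c * a + s * b| <= 2 * t.
Proof.
move=> c1 s1 at_ bt; rewrite (le_trans (ler_normD _ _))// !normrM mulr2n mulrDl mul1r.
by rewrite lerD// -[leRHS]mul1r ler_pM.
Qed.

Lemma cos_norm_le1 (x : R) : `|cos x| <= 1.
Proof. by rewrite ler_norml cos_le1 cos_geN1. Qed.

Lemma sin_norm_le1 (x : R) : `|sin x| <= 1.
Proof. by rewrite ler_norml sin_le1 sin_geN1. Qed.

Lemma wave_pairing_le eta th w ep phi (C : R) :
  (forall y, Normc.normc (phi (w + ep *: y)) <= C * weight y) ->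
  Normc.normc (wave_pairing eta th w ep phi) <= 4 * @weight_mean R d * C.
Proof.
move=> hC; rewrite (le_trans (normc_le_ReIm _))//=.
have -> : 4 * @weight_mean R d * C = 2 * C * @weight_mean R d + 2 * C * @weight_mean R d.
  by ring.
apply: lerD; apply: gmean_le => y; rewrite -mulrA -?mulrN -?mulNr;
  apply: cos_sin_lin_le; rewrite ?normrN ?cos_norm_le1 ?sin_norm_le1//;
  by rewrite (le_trans _ (hC y))// ?Re_le_normc ?Im_le_normc.
Qed.

(** One bound for finitely many seminorms. Estimates are kept linear in [B], so that the same ones
    serve for the decay of the transform and for continuity on Schwartz functions. *)
Definition schwartz_le N (B : R) phi : Prop :=
  forall k (s : seq 'I_d), (k <= N)%N -> (size s <= N)%N ->
  forall x, jbracket x ^+ k * Normc.normc (cpartials s phi x) <= B.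

(** No cancellation is involved. Writing w = v - ep y with v the point where phi is evaluated, a
    large coordinate of w forces one of v, where phi decays, or of y, where [weight] absorbs the
    power. *)
Lemma wave_pairing_spatial_decay (N : nat) : exists2 K : R, 0 <= K &
  forall phi B, schwartz_le N B phi -> forall i eta th w ep, 0 <= ep <= 1 ->
    `|w 0 i| ^+ N * Normc.normc (wave_pairing eta th w ep phi) <= K * B.
Proof.
exists (4 * @weight_mean R d * (2 ^+ N * (1 + N`!%:R))).
  have CW : 0 <= @weight_mean R d by rewrite exprn_ge0// mulr_ge0// expR_ge0.
  by rewrite !mulr_ge0// addr_ge0.
move=> phi B hB i eta th w ep /andP[e0 e1].
have B0 : 0 <= B.
  by apply: le_trans (hB 0%N [::] isT isT 0); rewrite expr0 mul1r normc_ge0.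
(* The division below excludes a zero coordinate; there N = 0 still needs an argument since 0^0 =
   1. *)
have [w0|wp] := eqVneq (w 0 i) 0.
  case: N hB => [|N] hB; last first.
    rewrite w0 normr0 expr0n/= mul0r -mulrA mulr_ge0 ?mulr_ge0 ?addr_ge0//.
    by rewrite exprn_ge0// mulr_ge0// expR_ge0.
  rewrite expr0 mul1r -mulrA; apply: wave_pairing_le => y.
  have := hB 0%N [::] isT isT (w + ep *: y); rewrite !expr0 mul1r/= => h.
  rewrite (le_trans h)// mul1r -[leLHS]mul1r -mulrA ler_pM//.
    by rewrite lerDl.
  by rewrite -[leLHS]mulr1 ler_wpM2l// weight_ge1.
have wN : 0 < `|w 0 i| ^+ N by rewrite exprn_gt0// normr_gt0.
set c := 2 ^+ N * (1 + N`!%:R).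
rewrite mulrC -ler_pdivlMr//.
have -> : 4 * @weight_mean R d * c * B / `|w 0 i| ^+ N =
    4 * @weight_mean R d * (c * (B / `|w 0 i| ^+ N)) by rewrite !mulrA.
apply: wave_pairing_le => y.
rewrite (mulrA c) mulrAC ler_pdivlMr// mulrC.
set v := w + ep *: y; set q := Normc.normc _.
have q0 : 0 <= q := normc_ge0 _.
have qB : q <= B by have := hB 0%N [::] isT isT v; rewrite expr0 mul1r.
have wv : `|w 0 i| <= `|v 0 i| + `|y 0 i|.
  have -> : w 0 i = v 0 i - ep * y 0 i by rewrite !mxE addrK.
  rewrite (le_trans (ler_normB _ _))// lerD2l normrM ger0_norm//.
  by rewrite -[leRHS]mul1r ler_wpM2r.
have h1 : `|v 0 i| ^+ N * q <= B.
  rewrite (le_trans _ (hB N [::] (leqnn N) isT v))// ler_wpM2r// lerXn2r//.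
    by rewrite nnegrE (le_trans ler01)// jbracket_ge1.
  exact: coord_le_jbracket.
have h2 : `|y 0 i| ^+ N * q <= N`!%:R * weight y * B.
  by rewrite ler_pM ?exprn_ge0// coord_exp_le_weight.
have h3 : (`|v 0 i| + `|y 0 i|) ^+ N <= 2 ^+ N * (`|v 0 i| ^+ N + `|y 0 i| ^+ N).
  exact: exprD_le.
have wN' : `|w 0 i| ^+ N <= (`|v 0 i| + `|y 0 i|) ^+ N.
  by rewrite lerXn2r ?nnegrE ?addr_ge0.
apply: le_trans (ler_wpM2r q0 (le_trans wN' h3)) _.
rewrite -mulrA /c -!mulrA ler_wpM2l ?exprn_ge0// mulrDl mulrDl lerD//.
  by rewrite (le_trans h1)// mul1r mulrC -[leLHS]mul1r ler_wpM2r// weight_ge1.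
by rewrite (le_trans h2)// -mulrA [weight y * B]mulrC.
Qed.

Lemma schwartz_le_jet (N : nat) B phi i : schwartz_le N B phi ->
  forall j y, (j <= N)%N -> Normc.normc (cpartials (nseq j i) phi y) <= B.
Proof.
move=> hB j y jN; have := hB 0%N (nseq j i) isT; rewrite size_nseq => /(_ jN y).
by rewrite expr0 mul1r.
Qed.

Lemma wave_pairingE i eta th w ep phi : schwartz phi ->
  wave_pairing eta th w ep phi =
  ((gmean (wave eta (th + pi / 2) i 0 w ep (fun y => complex.Re (phi y))) +
     gmean (wave eta th i 0 w ep (fun y => complex.Im (phi y))))
   +i* (gmean (wave eta th i 0 w ep (fun y => complex.Re (phi y))) -
     gmean (wave eta (th + pi / 2) i 0 w ep (fun y => complex.Im (phi y)))))%C.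
Proof.
move=> sphi; have [[_ rB] [_ iB]] := jet_derivative_family i sphi.
have dr t : dominated (wave eta t i 0 w ep (fun y => complex.Re (phi y))).
  by apply: dominated_wave; exact: rB 0%N.
have di t : dominated (wave eta t i 0 w ep (fun y => complex.Im (phi y))).
  by apply: dominated_wave; exact: iB 0%N.
congr (_ +i* _)%C.
  rewrite -[X in X + _]mul1r -gmean_lin//; congr gmean; apply/funext => y.
  by rewrite /wave addrA sinDpihalf expr0; ring.
rewrite addrC -mulN1r -gmean_lin//; congr gmean; apply/funext => y.
by rewrite /wave addrA sinDpihalf expr0; ring.
Qed.

Lemma wave_pairing_frequency_decay (N : nat) i : exists2 K : R, 0 <= K &
  forall phi B, schwartz phi -> schwartz_le N B phi ->
  forall eta th w ep, 0 <= ep <= 1 ->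
    `|eta 0 i| ^+ N * Normc.normc (wave_pairing eta th w ep phi) <= K * B.
Proof.
have [K K0 hK] := @wave_decay R d i N 0; exists (4 * K); first by rewrite mulr_ge0.
move=> phi B sphi hB eta th w ep ep01.
have [fr fi] := jet_derivative_family i sphi.
have rB j y : (j <= N)%N -> `|complex.Re (cpartials (nseq j i) phi y)| <= B.
  by move=> jN; rewrite (le_trans (Re_le_normc _))// (schwartz_le_jet i hB).
have iB j y : (j <= N)%N -> `|complex.Im (cpartials (nseq j i) phi y)| <= B.
  by move=> jN; rewrite (le_trans (Im_le_normc _))// (schwartz_le_jet i hB).
have hr t := hK _ fr B rB eta t w ep ep01.
have hi t := hK _ fi B iB eta t w ep ep01.
rewrite (wave_pairingE i)//.
have n0 : 0 <= `|eta 0 i| ^+ N by rewrite exprn_ge0.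
apply: le_trans (ler_wpM2l n0 (normc_le_ReIm _)) _ => /=.
have := hr th; have := hr (th + pi / 2); have := hi th; have := hi (th + pi / 2).
move=> /=; set a := gmean _; set b := gmean _; set a' := gmean _; set b' := gmean _.
move=> h1 h2 h3 h4.
have := ler_wpM2l n0 (lerD (ler_normD a' b) (ler_normB b' a)).
rewrite !mulrDr => h; apply: le_trans h _.
by rewrite -mulrA; lra.
Qed.

(** The sup norm of z' - z is attained at one coordinate. A position coordinate gives decay in the
    distance itself, a frequency coordinate only in [ep] times it; as ep <= 1 the latter is the
    common bound. *)
Lemma packet_decay (N : nat) : exists2 K : R, 0 <= K &
  forall phi B, schwartz phi -> schwartz_le N B phi ->
  forall z z' ep, 0 <= ep <= 1 ->
    (ep * `|z' - z|) ^+ N *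
      Normc.normc (packet z' ep (modulation z.2 (translation z.1 phi))) <= K * B.
Proof.
pose c : R := 4 * @weight_mean R d.
have c0 : 0 <= c by rewrite mulr_ge0// exprn_ge0// mulr_ge0// expR_ge0.
have [K1 K10 h1] := wave_pairing_spatial_decay N.
(* The constant may depend on the coordinate; the sum of all of them serves every one. *)
pose K2 i := s2val (cid2 (wave_pairing_frequency_decay N i)).
have K20 i : 0 <= K2 i by rewrite /K2; case: cid2.
have h2 i : forall phi B, schwartz phi -> schwartz_le N B phi ->
    forall eta th w ep, 0 <= ep <= 1 ->
    `|eta 0 i| ^+ N * Normc.normc (wave_pairing eta th w ep phi) <= K2 i * B.
  by rewrite /K2; case: cid2.
have S0 : 0 <= \sum_i K2 i by apply: sumr_ge0.
exists (c + K1 + \sum_i K2 i); first by rewrite !addr_ge0.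
move=> phi B sphi hB z z' ep ep01; rewrite packet_modulation_translation.
have [e0 e1] := andP ep01.
have B0 : 0 <= B.
  by apply: le_trans (hB 0%N [::] isT isT 0); rewrite expr0 mul1r normc_ge0.
set X := Normc.normc _.
have hX : X <= c * B.
  apply: wave_pairing_le => y.
  have := hB 0%N [::] isT isT (z'.1 - z.1 + ep *: y); rewrite expr0 mul1r => h.
  by rewrite (le_trans h)// -[leLHS]mulr1 ler_wpM2l// weight_ge1.
have X0 : 0 <= X := normc_ge0 _.
have small (t : R) : 0 <= t <= 1 -> t ^+ N * X <= (c + K1 + \sum_i K2 i) * B.
  move=> /andP[t0 t1]; apply: le_trans (_ : c * B <= _).
    by rewrite (le_trans _ hX)// -[leRHS]mul1r ler_wpM2r// exprn_ile1.
  by rewrite ler_wpM2r// -addrA lerDl addr_ge0.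
have -> : `|z' - z| = Num.max `|z'.1 - z.1| `|z'.2 - z.2| by rewrite prod_normE.
have [lt12|lt21] := leP `|z'.1 - z.1| `|z'.2 - z.2|.
  have [E|[i E]] := rV_norm_attained (z'.2 - z.2).
    by rewrite E mulr0 small// lexx ler01.
  have -> : ep * `|z'.2 - z.2| = `|(ep *: (z'.2 - z.2)) 0 i|.
    by rewrite mxE normrM E ger0_norm.
  apply: le_trans (h2 i _ _ sphi hB _ _ _ _ ep01) _.
  rewrite ler_wpM2r// (bigD1 i)//= addrCA lerDl !addr_ge0//.
  exact: sumr_ge0.
have [E|[i E]] := rV_norm_attained (z'.1 - z.1).
  by rewrite E mulr0 small// lexx ler01.
rewrite E; apply: le_trans (_ : `|(z'.1 - z.1) 0 i| ^+ N * X <= _).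
  rewrite ler_wpM2r// lerXn2r ?nnegrE ?mulr_ge0//.
  by rewrite -[leRHS]mul1r ler_wpM2r.
apply: le_trans (h1 _ _ hB _ _ _ _ _ ep01) _.
by rewrite ler_wpM2r// -addrA addrCA lerDl addr_ge0.
Qed.

End Packet.

(** * Sums of geometrically bounded sequences *)

Section GeneralizedSum.
Context {R : realType}.
Implicit Types (a b : nat -> R) (c C : R).

Lemma sum_half_le m : \sum_(j < m) (2^-1 : R) ^+ j <= 2.
Proof.
suff -> : \sum_(j < m) (2^-1 : R) ^+ j = 2 - 2 * 2^-1 ^+ m.
  by rewrite lerBlDr lerDl mulr_ge0// exprn_ge0// invr_ge0.
elim: m => [|m IH]; first by rewrite big_ord0 expr0 mulr1 subrr.
by rewrite big_ord_recr/= IH exprS; field.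
Qed.

(** The ordinary sum of the series whenever [geometric_le] holds; the ultrafilter limit yields
    linearity and bounds directly. *)
Definition gsum a : R := ulim (fun m => \sum_(j < m) a j).

Definition geometric_le a C : Prop := forall j, `|a j| <= C * 2^-1 ^+ j.

Lemma geometric_sum_le a C m (P : pred 'I_m) : 0 <= C ->
  (forall j : 'I_m, P j -> `|a j| <= C * 2^-1 ^+ j) ->
  `|\sum_(j < m | P j) a j| <= 2 * C.
Proof.
move=> C0 h; rewrite (le_trans (ler_norm_sum _ _ _))//.
apply: le_trans (ler_sum _ h) _; rewrite -mulr_sumr mulrC ler_wpM2r//.
apply: le_trans (sum_half_le m); rewrite big_mkcond/=.
by apply: ler_sum => j _; case: ifP => // _; rewrite exprn_ge0// invr_ge0.
Qed.

Lemma geometric_le_ge0 a C : geometric_le a C -> 0 <= C.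
Proof. by move=> /(_ 0%N); rewrite expr0 mulr1; apply: le_trans. Qed.

Lemma seq_bounded_partial_sums a C : geometric_le a C ->
  seq_bounded (fun m => \sum_(j < m) a j).
Proof.
move=> aC; exists (2 * C) => m; apply: geometric_sum_le => //.
exact: geometric_le_ge0 aC.
Qed.

Lemma gsum_lin c a b A B : geometric_le a A -> geometric_le b B ->
  gsum (fun j => c * a j + b j) = c * gsum a + gsum b.
Proof.
move=> aA bB; rewrite /gsum -ulim_lin; try exact: seq_bounded_partial_sums.
by congr ulim; apply/funext => m; rewrite big_split/= mulr_sumr.
Qed.

Lemma gsum_le a C : geometric_le a C -> `|gsum a| <= 2 * C.
Proof.
move=> aC; apply: (@ulim_le R 0); first exact: seq_bounded_partial_sums aC.
by move=> m _; apply: geometric_sum_le => //; exact: geometric_le_ge0 aC.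
Qed.

Lemma gsum_near a k C : 0 <= C -> (forall j, j != k -> `|a j| <= C * 2^-1 ^+ j) ->
  `|gsum a - a k| <= 2 * C.
Proof.
(* [D] absorbs the uncontrolled term [a k] and only serves to make the partial sums bounded; it does
   not enter the final estimate. *)
move=> C0 aC; pose D := C + `|a k| * 2 ^+ k.
have aD : geometric_le a D.
  move=> j; rewrite /D; have [->|jk] := eqVneq j k.
    rewrite mulrDl -mulrA -exprMn divff// expr1n mulr1 lerDr.
    by rewrite mulr_ge0// exprn_ge0// invr_ge0.
  rewrite (le_trans (aC _ jk))// ler_wpM2r ?exprn_ge0 ?invr_ge0//.
  by rewrite lerDl mulr_ge0// exprn_ge0.
have sb := seq_bounded_partial_sums aD.
have cb : seq_bounded (fun=> - a k : R) by exists `|a k| => _; rewrite normrN.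
rewrite /gsum -[X in `|X + _|]mul1r -(@ulim_cst _ (- a k)) -ulim_lin//.
(* A partial sum contains the index k from m = k + 1 on, and [a k] then cancels. *)
apply: (@ulim_le R k.+1); first exact: seq_bounded_lin.
move=> m km; rewrite mul1r (bigD1 (Ordinal km))//= addrAC subrr add0r.
by apply: geometric_sum_le => // j jk; apply: aC.
Qed.

Definition csum (a : nat -> R[i]) : R[i] :=
  (gsum (fun j => complex.Re (a j)) +i* gsum (fun j => complex.Im (a j)))%C.

Definition cgeometric_le (a : nat -> R[i]) C : Prop :=
  forall j, Normc.normc (a j) <= C * 2^-1 ^+ j.

Lemma csum_lin (c : R[i]) (a b : nat -> R[i]) A B :
  cgeometric_le a A -> cgeometric_le b B ->
  csum (fun j => c * a j + b j) = c * csum a + csum b.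
Proof.
move=> aA bB; case: c => s t.
have ra : geometric_le (fun j => complex.Re (a j)) A.
  by move=> j; rewrite (le_trans (Re_le_normc _)).
have ia : geometric_le (fun j => complex.Im (a j)) A.
  by move=> j; rewrite (le_trans (Im_le_normc _)).
have rb : geometric_le (fun j => complex.Re (b j)) B.
  by move=> j; rewrite (le_trans (Re_le_normc _)).
have ib : geometric_le (fun j => complex.Im (b j)) B.
  by move=> j; rewrite (le_trans (Im_le_normc _)).
have lin (x y : R) f g h F G H : geometric_le f F -> geometric_le g G ->
    geometric_le h H -> gsum (fun j => x * f j + (y * g j + h j)) =
    x * gsum f + (y * gsum g + gsum h).
  move=> fF gG hH; rewrite (@gsum_lin _ _ _ F (`|y| * G + H))//.
    by rewrite (gsum_lin _ gG hH).
  move=> j; rewrite (le_trans (ler_normD _ _))// mulrDl lerD// normrM -mulrA.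
  by rewrite ler_wpM2l.
rewrite /csum; apply/eqP; rewrite eq_complex/=; apply/andP; split; apply/eqP.
  have := lin s (- t) _ _ _ _ _ _ ra ia rb; rewrite addrA mulNr => <-.
  by congr gsum; apply/funext => j; case: (a j) => ? ?; case: (b j) => ? ? /=; ring.
have := lin s t _ _ _ _ _ _ ia ra ib; rewrite addrA => <-.
by congr gsum; apply/funext => j; case: (a j) => ? ?; case: (b j) => ? ? /=; ring.
Qed.

Lemma csum_le (a : nat -> R[i]) C : cgeometric_le a C -> Normc.normc (csum a) <= 4 * C.
Proof.
move=> aC; rewrite (le_trans (normc_le_ReIm _))//=.
have -> : 4 * C = 2 * C + 2 * C by ring.
by apply: lerD; apply: gsum_le => j; rewrite (le_trans _ (aC j))//
  ?Re_le_normc ?Im_le_normc.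
Qed.

Lemma csum_near (a : nat -> R[i]) k C : 0 <= C ->
  (forall j, j != k -> Normc.normc (a j) <= C * 2^-1 ^+ j) ->
  Normc.normc (csum a - a k) <= 4 * C.
Proof.
move=> C0 aC; rewrite (le_trans (normc_le_ReIm _))//.
have -> : 4 * C = 2 * C + 2 * C by ring.
rewrite !raddfB/=; apply: lerD.
  apply: (@gsum_near (fun j => complex.Re (a j))) => // j jk.
  by rewrite (le_trans _ (aC j jk))// Re_le_normc.
apply: (@gsum_near (fun j => complex.Im (a j))) => // j jk.
by rewrite (le_trans _ (aC j jk))// Im_le_normc.
Qed.

End GeneralizedSum.

(** * Linear structure and seminorms of Schwartz functions *)

Section SchwartzLinear.
Context {R : realType} {d : nat}.
Implicit Types (f g : 'rV[R]_d -> R[i]) (x y : 'rV[R]_d) (a : R[i]).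

Lemma differentiable_lin3 (s t : R) (p q r : 'rV[R]_d -> R) x :
  differentiable p x -> differentiable q x -> differentiable r x ->
  differentiable (fun y => s * p y + (t * q y + r y)) x.
Proof.
move=> dp dq dr.
have := differentiableD (differentiableZ s dp)
  (differentiableD (differentiableZ t dq) dr).
exact.
Qed.

Lemma derive_lin3 (s t : R) (p q r : 'rV[R]_d -> R) x v :
  differentiable p x -> differentiable q x -> differentiable r x ->
  'D_v (fun y => s * p y + (t * q y + r y)) x =
  s * 'D_v p x + (t * 'D_v q x + 'D_v r x).
Proof.
move=> dp dq dr.
have Dp := derivableP (@diff_derivable _ _ _ _ _ v dp).
have Dq := derivableP (@diff_derivable _ _ _ _ _ v dq).
have Dr := derivableP (@diff_derivable _ _ _ _ _ v dr).
exact: (@derive_val _ _ _ _ _ _ _ (is_derive_lin s Dp (is_derive_lin t Dq Dr))).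
Qed.

Lemma Re_lin a f g : (fun y => complex.Re (a * f y + g y)) =
  (fun y => complex.Re a * complex.Re (f y) +
    (- complex.Im a * complex.Im (f y) + complex.Re (g y))).
Proof.
by apply/funext => y; case: a (f y) (g y) => ? ? [? ?] [? ?] /=; ring.
Qed.

Lemma Im_lin a f g : (fun y => complex.Im (a * f y + g y)) =
  (fun y => complex.Re a * complex.Im (f y) +
    (complex.Im a * complex.Re (f y) + complex.Im (g y))).
Proof.
by apply/funext => y; case: a (f y) (g y) => ? ? [? ?] [? ?] /=; ring.
Qed.

Lemma cdifferentiable_lin a f g x : cdifferentiable f x -> cdifferentiable g x ->
  cdifferentiable (fun y => a * f y + g y) x.
Proof.
by move=> [rf imf] [rg img]; split; rewrite ?Re_lin ?Im_lin;
  exact: differentiable_lin3.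
Qed.

Lemma cpartial_lin i a f g :
  (forall x, cdifferentiable f x) -> (forall x, cdifferentiable g x) ->
  cpartial i (fun y => a * f y + g y) =
  (fun x => a * cpartial i f x + cpartial i g x).
Proof.
move=> df dg; apply/funext => x; have [rf imf] := df x; have [rg img] := dg x.
rewrite /cpartial Re_lin Im_lin !derive_lin3//.
by case: a => s t; apply/eqP; rewrite eq_complex/=; apply/andP; split; apply/eqP; ring.
Qed.

Lemma cpartials_lin s a f g : csmooth f -> csmooth g ->
  cpartials s (fun y => a * f y + g y) =
  (fun x => a * cpartials s f x + cpartials s g x).
Proof.
move=> sf sg; elim: s => [//|i s IH] /=.
by rewrite -/(cpartials _ _) IH cpartial_lin.
Qed.

Lemma csmooth_lin a f g : csmooth f -> csmooth g -> csmooth (fun y => a * f y + g y).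
Proof.
move=> sf sg s x; rewrite cpartials_lin//; apply: cdifferentiable_lin.
  exact: sf.
exact: sg.
Qed.

Lemma schwartz_lin a f g : schwartz f -> schwartz g ->
  schwartz (fun y => a * f y + g y).
Proof.
move=> [sf bf] [sg bg]; split=> [|k s]; first exact: csmooth_lin.
have [A hA] := bf k s; have [B hB] := bg k s.
exists (Normc.normc a * A + B) => _ [x _ <-]; rewrite cpartials_lin//.
have j0 : 0 <= jbracket x ^+ k by rewrite exprn_ge0// sqrtr_ge0.
apply: le_trans (ler_wpM2l j0 (le_normcD _ _)) _.
rewrite Normc.normcM mulrDr lerD//; last by apply: hB; exists x.
by rewrite mulrCA ler_wpM2l ?normc_ge0//; apply: hA; exists x.
Qed.

Lemma schwartz_range_le_seminorm k s f x : schwartz f ->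
  jbracket x ^+ k * Normc.normc (cpartials s f x) <= schwartz_seminorm k s f.
Proof.
move=> [_ bf]; apply: sup_upper_bound; last by exists x.
split; last exact: bf.
by exists (jbracket x ^+ k * Normc.normc (cpartials s f x)), x.
Qed.

Lemma schwartz_le_seminorm N (B : R) f : schwartz f ->
  (forall k s, (k <= N)%N -> (size s <= N)%N -> schwartz_seminorm k s f <= B) ->
  schwartz_le N B f.
Proof.
move=> sf h k s kN sN x; apply: le_trans (h k s kN sN).
exact: schwartz_range_le_seminorm.
Qed.

Lemma schwartz_le_exists N f : schwartz f -> exists B, schwartz_le N B f.
Proof.
move=> sf; have [_ bf] := sf.
have sem0 k s : 0 <= schwartz_seminorm k s f.
  apply: le_trans (_ : jbracket (0 : 'rV[R]_d) ^+ k * Normc.normc (cpartials s f 0) <= _).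
    by rewrite mulr_ge0 ?normc_ge0// exprn_ge0// sqrtr_ge0.
  exact: schwartz_range_le_seminorm.
(* The seminorms are nonnegative, so their sum bounds each of them; tuples make the set of
   multi-indices finite. *)
exists (\sum_(k < N.+1) \sum_(n < N.+1) \sum_(s : n.-tuple 'I_d) schwartz_seminorm k s f).
apply: schwartz_le_seminorm => // k s kN sN.
rewrite (bigD1 (Ordinal (kN : (k < N.+1)%N)))//= (bigD1 (Ordinal (sN : (size s < N.+1)%N)))//=.
rewrite (bigD1 (in_tuple s))//= -!addrA lerDl !addr_ge0//;
  do ?[apply: sumr_ge0 => *]; exact: sem0.
Qed.

Definition cbounded f : Prop := exists B, forall y, Normc.normc (f y) <= B.

Lemma schwartz_cbounded f : schwartz f -> cbounded f.
Proof.
move=> [_ bf]; have [B hB] := bf 0%N [::]; exists B => y.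
by apply: hB; exists y => //; rewrite expr0 mul1r.
Qed.

Lemma wave_pairing_lin eta th w (ep : R) a f g : cbounded f -> cbounded g ->
  wave_pairing eta th w ep (fun y => a * f y + g y) =
  (a^*)%C * wave_pairing eta th w ep f + wave_pairing eta th w ep g.
Proof.
move=> [A fA] [B gB].
have dom (c s : 'rV[R]_d -> R) (h : 'rV[R]_d -> R[i]) H : (forall y, Normc.normc (h y) <= H) ->
    (forall y, `|c y| <= 1) -> (forall y, `|s y| <= 1) ->
    dominated (fun y => c y * complex.Re (h (w + ep *: y)) +
                        s y * complex.Im (h (w + ep *: y))).
  move=> hH c1 s1; exists (2 * H) => y.
  apply: le_trans (_ : 2 * H <= _); last first.
    rewrite -[leLHS]mulr1 ler_wpM2l ?weight_ge1// mulr_ge0//.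
    exact: le_trans (normc_ge0 _) (hH 0).
  apply: cos_sin_lin_le => //; rewrite (le_trans _ (hH (w + ep *: y)))//.
    exact: Re_le_normc.
  exact: Im_le_normc.
pose c y := cos (dotr eta y + th); pose s y := sin (dotr eta y + th).
have c1 y : `|c y| <= 1 by exact: cos_norm_le1.
have s1 y : `|s y| <= 1 by exact: sin_norm_le1.
have domC h H : (forall y, Normc.normc (h y) <= H) ->
    dominated (fun y => c y * complex.Re (h (w + ep *: y)) +
                        s y * complex.Im (h (w + ep *: y))).
  by move=> hH; exact: dom hH c1 s1.
have domS h H : (forall y, Normc.normc (h y) <= H) ->
    dominated (fun y => s y * complex.Re (h (w + ep *: y)) -
                        c y * complex.Im (h (w + ep *: y))).
  move=> hH; have [|D hD] := dom s (fun y => - c y) h H hH s1.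
    by move=> y; rewrite normrN.
  by exists D => y; rewrite -mulNr; exact: hD.
have lin3 (x y : R) F G H : dominated F -> dominated G -> dominated H ->
   gmean (fun z : 'rV[R]_d => x * F z + (y * G z + H z)) =
   x * gmean F + (y * gmean G + gmean H).
  by move=> dF dG dH; rewrite gmean_lin ?(gmean_lin _ dG dH)//; exact: dominated_lin.
case: a => al be; rewrite /wave_pairing; apply/eqP; rewrite eq_complex/=.
apply/andP; split; apply/eqP.
  have := lin3 al be _ _ _ (domC _ _ fA) (domS _ _ fA) (domC _ _ gB).
  rewrite addrA mulNr opprK => <-; congr gmean; apply/funext => y.
  by rewrite /c /s; case: (f _) => ? ?; case: (g _) => ? ? /=; ring.
have := lin3 al (- be) _ _ _ (domS _ _ fA) (domC _ _ fA) (domS _ _ gB).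
rewrite addrA => <-; congr gmean; apply/funext => y.
by rewrite /c /s; case: (f _) => ? ?; case: (g _) => ? ? /=; ring.
Qed.

End SchwartzLinear.

(** * The Gaussian as a Schwartz window *)

Section Gaussian.
Context {R : realType} {d : nat}.
Implicit Types (f g : 'rV[R]_d -> R) (x y : 'rV[R]_d) (i : 'I_d).

Definition gaussian y : R := expR (- (dotr y y / 2)).

(** Polynomials times the Gaussian, given by generators so that closure under derivatives and rapid
    decay follow by induction. *)
Inductive hermite : ('rV[R]_d -> R) -> Prop :=
| hermite_gaussian : hermite gaussian
| hermite_coord i f : hermite f -> hermite (fun y => y 0 i * f y)
| hermite_lin (c : R) f g : hermite f -> hermite g ->
    hermite (fun y => c * f y + g y).

Lemma differentiable_dotr_self x : differentiable (fun y => dotr y y) x.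
Proof.
have -> : (fun y => dotr y y) = \sum_i (fun y : 'rV[R]_d => y 0 i * y 0 i).
  by apply/funext => y; rewrite fct_sumE.
apply: differentiable_sum => i.
by apply: differentiableM; exact: differentiable_coord.
Qed.

Lemma differentiable_gaussian x : differentiable gaussian x.
Proof.
apply: (@differentiable_comp _ _ _ _ (fun y => - (dotr y y / 2)) expR).
  apply: differentiableN; apply: differentiableM; last exact: differentiable_cst.
  exact: differentiable_dotr_self.
by apply/derivable1_diffP; exact: derivable_expR.
Qed.

Lemma is_derive_gaussian i x :
  is_derive x (delta_mx 0 i) gaussian (- x 0 i * gaussian x).
Proof.
have D : is_derive x (delta_mx 0 i) (fun y => - (dotr y y / 2)) (- x 0 i).
  apply/is_derive_line0.
  have -> : (fun h : R => - (dotr (h *: delta_mx 0 i + x) (h *: delta_mx 0 i + x) / 2)) =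
     (fun h : R => - (2^-1) * (h * h) + (- x 0 i * h + - (dotr x x / 2))).
    apply/funext => h; rewrite dotr_line dotrC dotr_line !mxE !eqxx/= mulr1.
    by field.
  have Dh : is_derive (0 : R) 1 (fun h : R => h * h) 0.
    by apply: is_derive_eq; rewrite scale0r addr0.
  have Di : is_derive (0 : R) 1 (fun h : R => h) 1 by exact: is_derive_id.
  have Dc : is_derive (0 : R) 1 (fun h : R => - (dotr x x / 2)) 0.
    exact: is_derive_cst.
  have := is_derive_lin (- 2^-1) Dh (is_derive_lin (- x 0 i) Di Dc).
  by rewrite mulr0 add0r mulr1 addr0.
have := is_derive_postcomp D (is_derive_expR _).
by rewrite mulrC.
Qed.

Lemma hermite_differentiable f x : hermite f -> differentiable f x.
Proof.
elim=> {f} [|i f _ IH|c f g _ IHf _ IHg]; first exact: differentiable_gaussian.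
  by apply: differentiableM => //; exact: differentiable_coord.
exact: differentiableD (differentiableZ c IHf) IHg.
Qed.

Lemma hermite_derive i f : hermite f -> hermite (fun x => 'D_(delta_mx 0 i) f x).
Proof.
elim=> {f} [|j f hf IH|c f g hf IHf hg IHg].
- have h := hermite_coord i hermite_gaussian.
  (* The multiple -1 is written as -2 + 1 to fit the shape c f + g of [hermite_lin]. *)
  rewrite (_ : (fun _ => _) = (fun x => - 2 * (x 0 i * gaussian x) + x 0 i * gaussian x)).
    exact: hermite_lin.
  by apply/funext => x; rewrite (@derive_val _ _ _ _ _ _ _ (is_derive_gaussian i x)); ring.
- rewrite (_ : (fun _ => _) = (fun x => (i == j)%:R * f x + x 0 j * 'D_(delta_mx 0 i) f x)).
    by apply: hermite_lin => //; exact: hermite_coord.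
  apply/funext => x.
  have Dc : is_derive x (delta_mx 0 i) (fun y : 'rV[R]_d => y 0 j) (i == j)%:R.
    apply/is_derive_line0; under eq_fun do rewrite !mxE/=.
    by apply: is_derive_eq; rewrite addr0 scaler0 add0r eq_sym [_ *: _]mulr1.
  have Df := derivableP
    (@diff_derivable _ _ _ _ _ (delta_mx 0 i) (hermite_differentiable x hf)).
  have := is_deriveM Dc Df => /(@derive_val _ _ _ _ _ _ _).
  rewrite addrC => E; rewrite [(_ == _)%:R * _]mulrC; exact: E.
- rewrite (_ : (fun _ => _) = (fun x => c * 'D_(delta_mx 0 i) f x + 'D_(delta_mx 0 i) g x)).
    exact: hermite_lin.
  apply/funext => x.
  have Df := derivableP
    (@diff_derivable _ _ _ _ _ (delta_mx 0 i) (hermite_differentiable x hf)).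
  have Dg := derivableP
    (@diff_derivable _ _ _ _ _ (delta_mx 0 i) (hermite_differentiable x hg)).
  exact: (@derive_val _ _ _ _ _ _ _ (is_derive_lin c Df Dg)).
Qed.

Lemma hermite_bounded f k : hermite f ->
  exists C : R, forall x, jbracket x ^+ k * `|f x| <= C.
Proof.
move=> hf; elim: hf k => {f} [|i f _ IH|c f g _ IHf _ IHg] k.
(* With r = |x|^2, the power ((1 + r)/2)^k is at most k! exp((1 + r)/2), and the Gaussian cancels
   all of this exponential but exp(1/2). *)
- exists (2 ^+ k * k`!%:R * expR 2^-1) => x.
  rewrite ger0_norm ?expR_ge0//; set r := dotr x x.
  have r0 : 0 <= r := dotr_ge0 x.
  apply: le_trans (_ : (1 + r) ^+ k * gaussian x <= _).
    rewrite ler_wpM2r ?expR_ge0//.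
    have -> : 1 + r = jbracket x ^+ 2 by rewrite sqr_sqrtr// addr_ge0.
    rewrite -exprM; apply: ler_weXn2l; first exact: jbracket_ge1.
    by rewrite mul2n -addnn leq_addr.
  have t0 : 0 <= (1 + r) / 2 by rewrite mulr_ge0 ?addr_ge0.
  have -> : (1 + r) ^+ k = 2 ^+ k * ((1 + r) / 2) ^+ k.
    by rewrite -exprMn; congr (_ ^+ _); field.
  rewrite -!mulrA ler_wpM2l ?exprn_ge0//.
  apply: le_trans (ler_wpM2r (expR_ge0 _) (exprn_le_expR k t0)) _.
  by rewrite -mulrA ler_wpM2l// -expRD ler_expR /gaussian -/r; lra.
- have [C hC] := IH k.+1; exists C => x; rewrite (le_trans _ (hC x))//.
  rewrite normrM exprSr -mulrA ler_wpM2l ?exprn_ge0 ?sqrtr_ge0//.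
  by rewrite ler_wpM2r// coord_le_jbracket.
- have [A hA] := IHf k; have [B hB] := IHg k; exists (`|c| * A + B) => x.
  have j0 : 0 <= jbracket x ^+ k by rewrite exprn_ge0// sqrtr_ge0.
  apply: le_trans (ler_wpM2l j0 (ler_normD _ _)) _.
  by rewrite mulrDr lerD// normrM mulrCA ler_wpM2l.
Qed.

Definition cgaussian : 'rV[R]_d -> R[i] := fun y => (gaussian y +i* 0)%C.

Lemma cpartials_cgaussian s : exists2 f, hermite f &
  cpartials s cgaussian = fun y => (f y +i* 0)%C.
Proof.
elim: s => [|i s [f hf E]]; first by exists gaussian => //; exact: hermite_gaussian.
exists (fun x => 'D_(delta_mx 0 i) f x); first exact: hermite_derive.
rewrite /= -/(cpartials s _) E; apply/funext => x; rewrite /cpartial/=.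
by congr (_ +i* _)%C; exact: derive_cst.
Qed.

Lemma schwartz_cgaussian : schwartz cgaussian.
Proof.
split=> [s x|k s]; have [f hf E] := cpartials_cgaussian s; rewrite ?/schwartz_range E.
  split; first exact: hermite_differentiable.
  exact: differentiable_cst.
have [C hC] := hermite_bounded k hf; exists C => _ [x _ <-].
by rewrite /= expr0n/= addr0 sqrtr_sqr.
Qed.

Lemma cgaussian_neq0 : cgaussian <> (fun=> 0).
Proof.
move=> /(congr1 (fun f : 'rV[R]_d -> R[i] => complex.Re (f 0))) /= /eqP.
by rewrite /gaussian gt_eqF// expR_gt0.
Qed.

End Gaussian.

(** * Centres in a cone and separation from a closed cone *)

Section ConicSets.
Context {R : realType} {d : nat}.
Local Notation phase_space := ('rV[R]_d * 'rV[R]_d)%type.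
Implicit Types (z p w : phase_space) (Gamma : set phase_space).

Lemma half_pow_near0 (a e : R) : 0 < e ->
  exists n, forall k, (n <= k)%N -> a * 2^-1 ^+ k <= e.
Proof.
move=> e0; have := archi_boundP (divr_ge0 (normr_ge0 a) (ltW e0)).
set n := Num.bound _ => hn; exists n => k nk.
have k2 : (k%:R : R) <= 2 ^+ k by rewrite -natrX ler_nat ltnW// ltn_expl.
have p2 : (0 : R) < 2 ^+ k by rewrite exprn_gt0.
rewrite exprVn ler_pdivrMr// (le_trans (ler_norm a))// mulrC -ler_pdivrMr//.
by rewrite (le_trans (ltW hn))// (le_trans _ k2)// ler_nat.
Qed.

Lemma rat_dense_rV (v : 'rV[R]_d) (e : R) : 0 < e ->
  exists q : 'rV[rat]_d, `|map_mx ratr q - v| < e.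
Proof.
move=> e0.
have rat_near i : exists q : rat, `|ratr q - v 0 i| < e.
  have [|q] := @rat_in_itvoo _ (v 0 i - e) (v 0 i + e); first by lra.
  by rewrite in_itv/= => /andP[h1 h2]; exists q; rewrite ltr_norml; apply/andP; lra.
pose q i := sval (cid (rat_near i)).
have hq i : `|ratr (q i) - v 0 i| < e by rewrite /q; case: cid.
exists (\row_i q i).
have [->//|[i ->]] := rV_norm_attained (map_mx ratr (\row_i q i) - v).
by rewrite !mxE.
Qed.

(** A point of Gamma is chosen in every ball with rational centre and radius 1/(m+1) that meets
    Gamma. Each choice has to recur at arbitrarily late indices, as the approximation is asked for
    beyond any n. *)
Lemma dense_sequence Gamma : Gamma !=set0 -> exists e : nat -> phase_space,
  (forall k, Gamma (e k)) /\
  forall z, Gamma z -> forall (delta : R) n, 0 < delta ->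
    exists2 k, (n <= k)%N & `|e k - z| < delta.
Proof.
move=> [z0 Gz0].
pose P (i : 'rV[rat]_d * 'rV[rat]_d * nat) p :=
  Gamma p /\ `|p - (map_mx ratr i.1.1, map_mx ratr i.1.2)| < i.2.+1%:R^-1.
pose g i := if pselect (exists p, P i p) is left h then sval (cid h) else z0.
have Gg i : Gamma (g i).
  by rewrite /g; case: pselect => // h; case: cid => p [].
(* The 2-adic valuation takes every value infinitely often. *)
pose e k := if unpickle (logn 2 k) is Some i then g i else z0.
exists e; split=> [k|z Gz delta n delta0].
  by rewrite /e; case: unpickle.
have [m hm] : exists m : nat, m.+1%:R^-1 <= delta / 2.
  have [m hm] := half_pow_near0 1 (divr_gt0 delta0 (ltr0Sn R 1)).
  exists (2 ^ m)%N; apply: le_trans (hm m (leqnn m)).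
  rewrite mul1r exprVn -natrX lef_pV2 ?posrE ?ltr0n ?expn_gt0//.
  by rewrite ler_nat.
have m0 : (0 : R) < m.+1%:R^-1 by rewrite invr_gt0.
have [q1 hq1] := rat_dense_rV z.1 m0; have [q2 hq2] := rat_dense_rV z.2 m0.
have Pz : P (q1, q2, m) z.
  by split => //=; rewrite distrC prod_normE/= gt_max hq1 hq2.
have Pg : P (q1, q2, m) (g (q1, q2, m)).
  rewrite /g; case: pselect => [h|]; first by case: cid.
  by move=> nP; exfalso; apply: nP; exists z.
set j := pickle (q1, q2, m).
(* The odd factor leaves the valuation at j and carries the index past n. *)
exists (2 ^ j * n.*2.+1)%N.
  rewrite (leq_trans _ (leq_pmull _ _)) ?expn_gt0//.
  by rewrite -addnn leqW// leq_addr.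
have -> : e (2 ^ j * n.*2.+1)%N = g (q1, q2, m).
  rewrite /e lognM ?expn_gt0// pfactorK// (_ : logn 2 n.*2.+1 = 0%N) ?addn0.
    by rewrite pickleK.
  by apply/eqP; rewrite lognE/= dvdn2/= odd_double.
pose q : phase_space := (map_mx ratr q1, map_mx ratr q2).
have h1 : `|z - q| < m.+1%:R^-1 by case: Pz.
have h2 : `|g (q1, q2, m) - q| < m.+1%:R^-1 by case: Pg.
have h := ler_distD q (g (q1, q2, m)) z; rewrite (distrC q) in h.
rewrite (le_lt_trans h)// (lt_le_trans (ltrD h2 h1))//.
by rewrite [leRHS](splitr delta) lerD.
Qed.

(** The dense sequence is rescaled to norms 4^k. A fixed shift w becomes negligible: scaled back by
    t_k, it has norm |e_k| |w| / 4^k, which tends to 0 along indices where e_k is near z. *)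
Lemma lacunary_sequence Gamma : Gamma `<=` [set~ 0] -> conic Gamma ->
  Gamma !=set0 -> exists zeta : nat -> phase_space,
  [/\ forall k, Gamma (zeta k), forall k, `|zeta k| = 4 ^+ k &
   forall Gamma0 z w n, open Gamma0 -> conic Gamma0 -> Gamma z -> Gamma0 z ->
     exists2 k, (n <= k)%N & Gamma0 (zeta k + w)].
Proof.
move=> Gamma0 coneG /dense_sequence[e [Ge dense]].
have e0 k : 0 < `|e k| by rewrite normr_gt0; apply/eqP; exact: Gamma0 (Ge k).
pose t k : R := 4 ^+ k / `|e k|.
have t0 k : 0 < t k by rewrite divr_gt0// exprn_gt0.
exists (fun k => t k *: e k); split=> [k|k|Gam0 z w n oG cG Gz G0z].
- exact: coneG.
- by rewrite normrZ gtr0_norm// divfK// gt_eqF.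
have [r /= r0 hr] : exists2 r : R, 0 < r & forall z', `|z' - z| < r -> Gam0 z'.
  have /nbhs_ballP[r /= r0 hr] : nbhs z Gam0 by exact: open_nbhs_nbhs.
  by exists r => // z' h; apply: hr; rewrite -ball_normE/= distrC.
have r2 : 0 < r / 2 by rewrite divr_gt0.
have r4 : 0 < r / 4 by rewrite divr_gt0.
(* Here |z| + r/2 bounds |e_k|, and 4^-k is weakened to 2^-k. *)
have [m hm] := half_pow_near0 ((`|z| + r / 2) * `|w|) r4.
have [k nk hk] := dense z Gz _ (maxn n m) r2.
move: nk; rewrite geq_max => /andP[nk mk]; exists k => //.
have -> : t k *: e k + w = t k *: (e k + (t k)^-1 *: w).
  by rewrite scalerDr scalerA divff ?gt_eqF// scale1r.
apply: cG => //; apply: hr.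
rewrite addrAC (le_lt_trans (ler_normD _ _))//.
have ek : `|e k| <= `|z| + r / 2.
  have -> : e k = z + (e k - z) by rewrite addrC subrK.
  by rewrite (le_trans (ler_normD _ _))// lerD2l ltW.
suff : `|(t k)^-1 *: w| <= r / 4 by lra.
rewrite normrZ gtr0_norm ?invr_gt0// (le_trans _ (hm _ mk))//.
rewrite mulrAC ler_wpM2r// invf_div ler_pM//.
rewrite exprVn lef_pV2 ?posrE ?exprn_gt0//.
by rewrite lerXn2r ?nnegrE// ler_nat.
Qed.

(** Homogeneity: when t z lies in a small ball about z0, t p still lies in Gamma, so t |p - z| is
    bounded below while t |z| is bounded above. *)
Lemma cone_separated Gamma z0 : closed (Gamma : set (subspace [set~ 0])) ->
  Gamma `<=` [set~ 0] -> conic Gamma -> z0 <> 0 -> ~ Gamma z0 ->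
  exists Gamma0, [/\ open_cone Gamma0, Gamma0 z0 & exists2 c : R, 0 < c &
    forall z p, Gamma0 z -> Gamma p -> c * `|z| <= `|p - z| /\ c * `|p| <= `|p - z|].
Proof.
move=> clG G0 cG /eqP z00 nGz0.
have [r r0 hr] : exists2 r : R, 0 < r & forall p, Gamma p -> r <= `|p - z0|.
  have /closed_subspaceP[C clC CG] := clG.
  have nC : ~ C z0.
    move=> Cz0; apply: nGz0.
    have : (C `&` [set~ 0]) z0 by split => //; exact/eqP.
    by rewrite CG => -[].
  have /nbhs_ballP[r /= r0 hr] : nbhs z0 (~` C).
    by apply: open_nbhs_nbhs; split => //; exact: closed_openC.
  exists r => // p Gp; rewrite leNgt; apply/negP => h.
  apply: (hr p); first by rewrite -ball_normE/= distrC.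
  have : (Gamma `&` [set~ 0]) p by split => //; exact: G0.
  by rewrite -CG => -[].
have nz0 : 0 < `|z0| by rewrite normr_gt0.
(* The first condition keeps the [del]-ball about z0 at distance [del] from Gamma, the second keeps
   0 out of the cone over it. *)
have [del del0 [delr delz]] : exists2 del : R, 0 < del & 2 * del <= r /\ del <= `|z0|.
  exists (Num.min r `|z0| / 2); first by rewrite divr_gt0// lt_min r0.
  by have := ge_min r r `|z0|; have := ge_min `|z0| r `|z0|; rewrite !lexx orbT/=; lra.
exists [set z | exists2 t : R, 0 < t & `|t *: z - z0| < del]; split.
- split.
  + rewrite openE => z /= [t t0 tz]; apply/nbhs_ballP.
    exists ((del - `|t *: z - z0|) / t) => /=; first by rewrite divr_gt0// subr_gt0.
    move=> z'; rewrite -ball_normE/= distrC ltr_pdivlMr// => h; exists t => //.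
    have -> : t *: z' - z0 = t *: (z' - z) + (t *: z - z0).
      by rewrite scalerBr addrA subrK.
    rewrite (le_lt_trans (ler_normD _ _))// normrZ gtr0_norm//.
    by rewrite mulrC; lra.
  + move=> s z s0 [t t0 tz]; exists (t / s); first by rewrite divr_gt0.
    by rewrite scalerA divfK// gt_eqF.
  + by move=> z [t t0 tz] E; move: tz; rewrite E scaler0 sub0r normrN ltNge delz.
- by exists 1; rewrite // scale1r subrr normr0.
have sum0 : 0 < `|z0| + del by rewrite addr_gt0.
pose c1 := del / (`|z0| + del).
have c10 : 0 < c1 by rewrite divr_gt0.
have c11 : 0 < 1 + c1 by rewrite addr_gt0.
(* [c1] works for |z|; with |p| <= D + |z| <= (1 + 1/c1) D this smaller constant works for |p|
   too. *)
exists (c1 / (1 + c1)); first by rewrite divr_gt0.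
move=> z p [t t0 tz] Gp; set D := `|p - z|.
have h1 : del <= t * D.
  have := hr _ (cG _ _ t0 Gp).
  have := ler_distD (t *: z) (t *: p) z0.
  by rewrite -scalerBr normrZ gtr0_norm// -/D; lra.
have h2 : t * `|z| <= `|z0| + del.
  rewrite -[t in leLHS]gtr0_norm// -normrZ -[t *: z](subrK z0) addrC.
  by rewrite (le_trans (ler_normD _ _))// lerD2l ltW.
have h3 : c1 * `|z| <= D.
  rewrite -(ler_pM2l t0) (le_trans _ h1)// mulrCA /c1 mulrAC ler_pdivrMr//.
  by rewrite ler_pM2l.
have D0 : 0 <= D := normr_ge0 _.
have h4 : `|p| <= D + `|z|.
  by rewrite -[p in leLHS](subrK z) ler_normD.
split; rewrite mulrAC ler_pdivrMr//; first by nra.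
have := ler_wpM2l (ltW c10) h4; nra.
Qed.

End ConicSets.

(** * The sum of packets: temperedness and decay off Gamma *)

Section PacketSum.
Context {R : realType} {d : nat}.
Local Notation phase_space := ('rV[R]_d * 'rV[R]_d)%type.
Implicit Types (z p w : phase_space) (f g phi : 'rV[R]_d -> R[i]).
Context (zeta : nat -> phase_space) (zeta_norm : forall k, `|zeta k| = 4 ^+ k).

Definition packet_sum f : R[i] := csum (fun k => packet (zeta k) (2^-1 ^+ k) f).

Lemma half_expr_itv k : 0 <= (2^-1 : R) ^+ k <= 1.
Proof.
by rewrite exprn_ge0 ?invr_ge0//= exprn_ile1 ?invr_ge0// invf_le1// ler1n.
Qed.

Lemma modulation_translation0 f : modulation 0 (translation 0 f) = f.
Proof.
apply/funext => y; rewrite /modulation /translation subr0 dotrC.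
have -> : dotr 0 y = 0 by rewrite /dotr big1// => i _; rewrite mxE mul0r.
by rewrite cos0 sin0; exact: mul1r.
Qed.

(** At z = 0 the quantity eps_k |zeta_k| is 2^k, so a single power of decay already makes the series
    geometric. *)
Lemma packet_geometric : exists2 K : R, 0 <= K &
  forall f B, schwartz f -> schwartz_le 1 B f ->
    cgeometric_le (fun k => packet (zeta k) (2^-1 ^+ k) f) (K * B).
Proof.
have [K K0 hK] := @packet_decay R d 1; exists K => // f B sf hB k.
have := hK f B sf hB 0 (zeta k) _ (half_expr_itv k).
rewrite /= modulation_translation0 subr0 zeta_norm expr1.
have -> : (2^-1 : R) ^+ k * 4 ^+ k = 2 ^+ k.
  by rewrite -exprMn; congr (_ ^+ _); field.
by rewrite mulrC -ler_pdivlMr ?exprn_gt0// exprVn.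
Qed.

Lemma packet_sum_lin a f g : schwartz f -> schwartz g ->
  packet_sum (fun x => a * f x + g x) = (a^*)%C * packet_sum f + packet_sum g.
Proof.
move=> sf sg; have [K K0 hK] := packet_geometric.
have [A hA] := schwartz_le_exists 1 sf; have [B hB] := schwartz_le_exists 1 sg.
rewrite /packet_sum -(csum_lin _ (hK _ _ sf hA) (hK _ _ sg hB)).
congr csum; apply/funext => k; apply: wave_pairing_lin; exact: schwartz_cbounded.
Qed.

Lemma packet_sum_tempered : tempered packet_sum.
Proof.
split=> [a f g sf sg|f e sf e0]; first exact: packet_sum_lin.
have [K K0 hK] := packet_geometric.
have K1 : 0 < 4 * K + 1 by rewrite ltr_wpDl// mulr_ge0.
(* The 4 comes from [csum_le]; adding 1 keeps the divisor positive and makes the final inequality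
   strict. *)
exists 1%N, (e / (4 * K + 1)); split=> [|g sg small]; first by rewrite divr_gt0.
pose h x := -1 * f x + g x.
have sh : schwartz h by exact: schwartz_lin.
have -> : packet_sum g - packet_sum f = packet_sum h.
  by rewrite packet_sum_lin// rmorphN1 mulN1r addrC.
have hB : schwartz_le 1 (e / (4 * K + 1)) h.
  apply: schwartz_le_seminorm => // k s k1 s1; apply: ltW.
  rewrite (_ : h = (fun x => g x - f x)); first exact: small.
  by apply/funext => x; rewrite /h mulN1r addrC.
apply: le_lt_trans (csum_le (hK h _ sh hB)) _.
rewrite mulrA mulrCA -[ltRHS]mulr1 ltr_pM2l// ltr_pdivrMr// mul1r.
by rewrite ltrDl.
Qed.

Lemma norm_le_jbracket2 z : `|z| <= jbracket2 z.
Proof.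
have le1 (v y : 'rV[R]_d) : `|v| <= Num.sqrt (1 + (dotr v v + dotr y y)).
  have [->|[i ->]] := rV_norm_attained v; first exact: sqrtr_ge0.
  rewrite -sqrtr_sqr ler_wsqrtr// /dotr (bigD1 i)//= -expr2.
  set s := \sum_(j < d | _) _.
  have s0 : 0 <= s by apply: sumr_ge0 => j _; rewrite -expr2 sqr_ge0.
  by have := dotr_ge0 y; rewrite /dotr; lra.
rewrite prod_normE/= ge_max /jbracket2; apply/andP; split; first exact: (le1 _ _).
by rewrite [dotr z.1 z.1 + _]addrC; exact: (le1 _ _).
Qed.

Lemma jbracket2_le z : jbracket2 z <= (2 * d%:R + 1) * (1 + `|z|).
Proof.
have dot_le (v : 'rV[R]_d) : `|v| <= `|z| -> dotr v v <= d%:R * `|z| ^+ 2.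
  move=> vz; rewrite -[d in d%:R]card_ord mulr_natl -sumr_const.
  apply: ler_sum => i _; rewrite -expr2 -[leLHS]real_normK ?num_real//.
  rewrite lerXn2r ?nnegrE//; exact: le_trans (coord_le_norm v i) vz.
have h : dotr z.1 z.1 + dotr z.2 z.2 <= 2 * d%:R * `|z| ^+ 2.
  by rewrite -mulrA mulr2n mulrDl mul1r lerD// dot_le//
    prod_normE/= le_max lexx ?orbT.
have d0 : 0 <= (d%:R : R) by [].
have z0 : 0 <= `|z| by [].
have p0 : 0 <= (2 * d%:R + 1) * (1 + `|z|) by rewrite mulr_ge0 ?addr_ge0 ?mulr_ge0.
rewrite -[leRHS]ger0_norm// -sqrtr_sqr ler_wsqrtr//.
rewrite (le_trans (lerD (lexx 1) h))// exprMn.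
apply: le_trans (_ : (2 * d%:R + 1) * (1 + `|z| ^+ 2) <= _).
  have : 0 <= (d%:R : R) * `|z| ^+ 2 by rewrite mulr_ge0// exprn_ge0.
  have : 0 <= `|z| ^+ 2 by rewrite exprn_ge0.
  by rewrite mulrDr mulr1 mulrDl mul1r; lra.
rewrite ler_pM// ?addr_ge0 ?mulr_ge0 ?exprn_ge0//.
  by rewrite expr2 -[leLHS]mulr1 ler_wpM2l ?addr_ge0 ?mulr_ge0// lerDr mulr_ge0.
by rewrite sqrrD expr1n mul1r -addrA lerD2l lerDr mulrn_wge0.
Qed.

(* Far from the centres, eps_k |zeta_k - z| is at least c 2^k and its square at
   least c^2 |z|. *)
Lemma stft_packet_sum_decay (Gamma0 : set phase_space) (c : R) phi (N : nat) :
  0 < c -> schwartz phi -> (forall z, Gamma0 z -> z <> 0) ->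
  (forall z k, Gamma0 z -> c * `|z| <= `|zeta k - z| /\ c * `|zeta k| <= `|zeta k - z|) ->
  exists C, forall z, Gamma0 z ->
    `|z| ^+ N * Normc.normc (stft phi packet_sum z) <= C.
Proof.
move=> c0 sphi nz0 sep.
(* Of these powers, 2N pay for |z|^N and the last one for the factor 2^-k that makes the series
   converge. *)
have [K K0 hK] := @packet_decay R d (N * 2).+1.
have [B hB] := schwartz_le_exists (N * 2).+1 sphi.
exists (4 * (K * B / c ^+ (N * 2).+1)) => z Gz.
have zp : 0 < `|z| by rewrite normr_gt0; apply/eqP; exact: nz0.
have zN : 0 < `|z| ^+ N by rewrite exprn_gt0.
rewrite mulrC -ler_pdivlMr// -(mulrA 4) /stft /packet_sum; apply: csum_le => k.
set X := Normc.normc _; have [s1 s2] := sep z k Gz.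
have := hK phi B sphi hB z (zeta k) _ (half_expr_itv k); rewrite -/X.
set D := `|zeta k - z| in s1 s2 *; set ep := 2^-1 ^+ k => hX.
have X0 : 0 <= X := normc_ge0 _.
have ep0 : 0 < ep by rewrite exprn_gt0// invr_gt0.
have ep4 : ep * 4 ^+ k = 2 ^+ k by rewrite -exprMn; congr (_ ^+ _); field.
rewrite zeta_norm in s2.
have e1 : c * 2 ^+ k <= ep * D by rewrite -ep4 mulrCA ler_pM2l.
have p2 : (0 : R) < 2 ^+ k by rewrite exprn_gt0.
have D0 : 0 <= D := normr_ge0 _.
(* One factor D is bounded below by c |z| and the other by c 4^k, the latter compensating ep^2 =
   4^-k. *)
have e2 : c ^+ 2 * `|z| <= (ep * D) ^+ 2.
  have -> : c ^+ 2 * `|z| = (ep * (c * `|z|)) * (ep * (c * 4 ^+ k)).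
    rewrite [ep * (c * 4 ^+ k)]mulrCA ep4.
    have E : ep * 2 ^+ k = 1 by rewrite -exprMn mulVf// expr1n.
    by transitivity (c ^+ 2 * `|z| * (ep * 2 ^+ k)); [rewrite E mulr1|ring].
  have n1 : 0 <= ep * (c * `|z|) by rewrite !mulr_ge0// ltW.
  have n2 : 0 <= ep * (c * 4 ^+ k) by rewrite !mulr_ge0 ?exprn_ge0// ltW.
  by rewrite expr2 ler_pM// ler_pM2l.
have e3 : c ^+ (N * 2).+1 * `|z| ^+ N * 2 ^+ k <= (ep * D) ^+ (N * 2).+1.
  have -> : c ^+ (N * 2).+1 * `|z| ^+ N * 2 ^+ k = (c ^+ 2 * `|z|) ^+ N * (c * 2 ^+ k).
    rewrite exprSr mulnC exprM [(_ * `|z|) ^+ N]exprMn; move: ((c ^+ 2) ^+ N) => A.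
    by ring.
  rewrite [leRHS]exprSr mulnC exprM.
  have a0 : 0 <= c ^+ 2 * `|z| by rewrite mulr_ge0// exprn_ge0// ltW.
  have b0 : 0 <= (ep * D) ^+ 2 := le_trans a0 e2.
  apply: ler_pM e1; [exact: exprn_ge0|by rewrite mulr_ge0// ltW|].
  exact: lerXn2r.
have e4 := le_trans (ler_wpM2r X0 e3) hX.
have cN : 0 < c ^+ (N * 2).+1 by rewrite exprn_gt0.
have -> : K * B / c ^+ (N * 2).+1 / `|z| ^+ N * ep =
    K * B / (c ^+ (N * 2).+1 * `|z| ^+ N * 2 ^+ k).
  by rewrite /ep exprVn !invfM !mulrA.
by rewrite ler_pdivlMr ?mulr_gt0// mulrC.
Qed.

Lemma stft_packet_sum_rapid (Gamma0 : set phase_space) (c : R) phi (N : nat) :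
  0 < c -> schwartz phi -> (forall z, Gamma0 z -> z <> 0) ->
  (forall z k, Gamma0 z -> c * `|z| <= `|zeta k - z| /\ c * `|zeta k| <= `|zeta k - z|) ->
  has_ubound [set jbracket2 z ^+ N * Normc.normc (stft phi packet_sum z) | z in Gamma0].
Proof.
move=> c0 sphi nz0 sep.
have [A hA] := stft_packet_sum_decay 0 c0 sphi nz0 sep.
have [B hB] := stft_packet_sum_decay N c0 sphi nz0 sep.
have m0 : 0 <= (2 * d%:R + 1 : R) by rewrite addr_ge0// mulr_ge0.
exists ((2 * d%:R + 1) ^+ N * (2 ^+ N * (A + B))) => _ [z Gz <-].
set X := Normc.normc _; have X0 : 0 <= X := normc_ge0 _.
have h : jbracket2 z ^+ N <= (2 * d%:R + 1) ^+ N * (2 ^+ N * (1 + `|z| ^+ N)).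
  apply: le_trans (_ : ((2 * d%:R + 1) * (1 + `|z|)) ^+ N <= _).
    by rewrite lerXn2r ?nnegrE ?sqrtr_ge0 ?jbracket2_le// mulr_ge0// addr_ge0.
  rewrite exprMn ler_wpM2l ?exprn_ge0//.
  by have := @exprD_le R 1 `|z| N ler01 (normr_ge0 _); rewrite expr1n.
apply: le_trans (ler_wpM2r X0 h) _.
rewrite -!mulrA ler_wpM2l ?exprn_ge0// ler_wpM2l ?exprn_ge0//.
rewrite mulrDl lerD//; last exact: hB.
by have := hA z Gz; rewrite expr0.
Qed.

End PacketSum.

(** * Lower bound near the centres *)

Section LowerBound.
Context {R : realType} {d : nat}.
Local Notation phase_space := ('rV[R]_d * 'rV[R]_d)%type.
Implicit Types (z p w : phase_space) (f g phi : 'rV[R]_d -> R[i]).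

Lemma normc_wave_pairing_cst th (w : 'rV[R]_d) (ep : R) (c : R[i]) :
  Normc.normc (wave_pairing (0 : 'rV[R]_d) th w ep (fun=> c)) = Normc.normc c.
Proof.
have dot0 y : dotr (0 : 'rV[R]_d) y = 0.
  by rewrite /dotr big1// => i _; rewrite mxE mul0r.
rewrite /wave_pairing; under eq_fun do rewrite dot0.
under [X in (_ +i* gmean X)%C]eq_fun do rewrite dot0.
rewrite !gmean_cst add0r; case: c => p q /=; congr Num.sqrt.
have := cos2Dsin2 th; set C := cos th; set S := sin th => CS.
transitivity ((C ^+ 2 + S ^+ 2) * (p ^+ 2 + q ^+ 2)); first by ring.
by rewrite CS mul1r.
Qed.

(** Continuity at y0 handles small v, boundedness the others. The linear form of the bound lets
    [weight] dominate it, and for v = ep y it yields a factor [ep]. *)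
Lemma cdifferentiable_modulus phi y0 (e : R) : 0 < e ->
  cdifferentiable phi y0 -> cbounded phi ->
  exists2 M : R, 0 <= M &
    forall v, Normc.normc (phi (y0 + v) - phi y0) <= e + M * `|v|.
Proof.
move=> e0 [dre dim] [B hB].
have e2 : 0 < e / 2 by rewrite divr_gt0.
have near0 (h : 'rV[R]_d -> R) : differentiable h y0 ->
    exists2 r : R, 0 < r & forall v, `|v| < r -> `|h (y0 + v) - h y0| < e / 2.
  move=> /differentiable_continuous /cvgrPdist_lt /(_ _ e2) /nbhs_ballP[r /= r0 hr].
  exists r => // v vr; rewrite distrC; apply: hr.
  by rewrite -ball_normE/= opprD addrA subrr add0r normrN.
have [r1 r10 h1] := near0 _ dre; have [r2 r20 h2] := near0 _ dim.
have B0 : 0 <= B := le_trans (normc_ge0 _) (hB y0).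
have r0 : 0 < Num.min r1 r2 by rewrite lt_min r10.
exists (2 * B / Num.min r1 r2); first by rewrite mulr_ge0 ?mulr_ge0// invr_ge0 ltW.
move=> v; have [vr|vr] := ltP `|v| (Num.min r1 r2).
  move: vr; rewrite lt_min => /andP[/h1 v1 /h2 v2].
  apply: le_trans (_ : e <= _).
    rewrite (le_trans (normc_le_ReIm _))// !raddfB/= [leRHS](splitr e).
    by rewrite lerD// ltW.
  by rewrite lerDl mulr_ge0// mulr_ge0 ?mulr_ge0// invr_ge0 ltW.
apply: le_trans (_ : 2 * B <= _).
  rewrite (le_trans (le_normcD _ _))// normcN mulr2n mulrDl mul1r.
  by rewrite lerD.
rewrite -[leLHS]add0r lerD ?(ltW e0)// mulrAC ler_pdivlMr//.
by rewrite ler_wpM2l// mulr_ge0.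
Qed.

(** At frequency 0 the pairing is, up to a phase, the mean of the conjugate of phi at scale [ep]
    about y0. It is compared with the pairing of the constant phi y0, whose modulus is exact. *)
Lemma wave_pairing_lower_bound phi y0 (e : R) : 0 < e ->
  cdifferentiable phi y0 -> cbounded phi ->
  exists2 M : R, 0 <= M & forall th ep, 0 <= ep ->
    Normc.normc (phi y0) - 4 * @weight_mean R d * (e + M * ep) <=
    Normc.normc (wave_pairing 0 th y0 ep phi).
Proof.
move=> e0 dphi bphi; have [M M0 hM] := cdifferentiable_modulus e0 dphi bphi.
exists M => // th ep ep0.
pose h x := -1 * (fun=> phi y0) x + phi x.
have bc : cbounded (fun _ : 'rV[R]_d => phi y0) by exists (Normc.normc (phi y0)).
have hsmall : Normc.normc (wave_pairing 0 th y0 ep h) <=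
    4 * @weight_mean R d * (e + M * ep).
  apply: wave_pairing_le => y.
  rewrite /h mulN1r addrC (le_trans (hM _))// mulrDl lerD//.
    by rewrite -[leLHS]mulr1 ler_wpM2l ?weight_ge1// ltW.
  rewrite normrZ ger0_norm// -mulrA ler_wpM2l// ler_wpM2l//.
  have [->|[i ->]] := rV_norm_attained y; first exact: weight_ge0.
  by have := coord_exp_le_weight y i 1; rewrite expr1 mul1r.
have E : wave_pairing 0 th y0 ep h =
    - wave_pairing 0 th y0 ep (fun=> phi y0) + wave_pairing 0 th y0 ep phi.
  by rewrite wave_pairing_lin// rmorphN1 mulN1r.
rewrite lerBlDr -(normc_wave_pairing_cst th y0 ep).
rewrite -[wave_pairing 0 th y0 ep (fun=> phi y0)]opprK normcN.
have -> : - wave_pairing 0 th y0 ep (fun=> phi y0) =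
    wave_pairing 0 th y0 ep h - wave_pairing 0 th y0 ep phi by rewrite E addrK.
by rewrite (le_trans (le_normcD _ _))// normcN addrC lerD2l.
Qed.

Context (zeta : nat -> phase_space) (zeta_norm : forall k, `|zeta k| = 4 ^+ k).

(* 4^max(j,k) exceeds 4^min(j,k) by a factor 4 at least when j <> k. *)
Lemma lacunary_gap (j k : nat) z : j != k -> `|z| <= 4 ^+ k / 4 ->
  2 ^+ j * 2 ^+ k / 4 <= (2^-1 ^+ j * `|zeta j - (zeta k + z)|) ^+ 2.
Proof.
move=> jk zk; set D := `|_ - (_ + _)|.
have D1 : `|zeta j| - `|zeta k| - `|z| <= D.
  have := ler_normD (zeta j - (zeta k + z)) (zeta k + z); rewrite subrK -/D.
  by have := ler_normD (zeta k) z; lra.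
have D2 : `|zeta k| - `|zeta j| - `|z| <= D.
  have := ler_normD (zeta k + z - zeta j) (zeta j); rewrite subrK distrC -/D.
  by have := ler_normB (zeta k + z) z; rewrite addrK; lra.
rewrite !zeta_norm in D1 D2.
have four n : (4 : R) ^+ n = 2 ^+ n * 2 ^+ n by rewrite -exprMn; congr (_ ^+ _); ring.
have pj : (0 : R) < 2 ^+ j by rewrite exprn_gt0.
have pk : (0 : R) < 2 ^+ k by rewrite exprn_gt0.
have -> : (2^-1 ^+ j * D) ^+ 2 = D ^+ 2 / (2 ^+ j) ^+ 2.
  by rewrite exprMn [2^-1 ^+ j]exprVn exprVn mulrC.
rewrite ler_pdivlMr ?exprn_gt0//.
(* In both cases the larger of 4^j and 4^k loses at most half of itself to the smaller one and to
   z. *)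
have [lt_jk|lt_kj|E] := ltngtP j k; last by rewrite E eqxx in jk.
- have h2 : 2 * 2 ^+ j <= (2 : R) ^+ k by rewrite -exprS ler_weXn2l// ler1n.
  have hD : 2 ^+ k * 2 ^+ k / 2 <= D by move: D2 zk; rewrite !four; nra.
  have D0 : 0 <= D := normr_ge0 _.
  apply: le_trans (_ : (2 ^+ k * 2 ^+ k / 2) ^+ 2 <= _); last first.
    by rewrite lerXn2r ?nnegrE// mulr_ge0// mulr_ge0// ltW.
  move: (2 ^+ j) (2 ^+ k) pj pk h2 => a b a0 b0 h2.
  have ab : a ^+ 2 <= b ^+ 2 by rewrite lerXn2r ?nnegrE ?ltW//; lra.
  have ab' : a * b <= b ^+ 2 by nra.
  have -> : (b * b / 2) ^+ 2 = b ^+ 2 / 4 * b ^+ 2 by field.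
  have n1 : 0 <= a * b / 4 by rewrite !mulr_ge0// ltW.
  have n2 : 0 <= a ^+ 2 by rewrite exprn_ge0// ltW.
  by apply: ler_pM n1 n2 _ ab; lra.
- have h2 : 2 * 2 ^+ k <= (2 : R) ^+ j by rewrite -exprS ler_weXn2l// ler1n.
  have hD : 2 ^+ j * 2 ^+ j / 2 <= D by move: D1 zk; rewrite !four; nra.
  have D0 : 0 <= D := normr_ge0 _.
  apply: le_trans (_ : (2 ^+ j * 2 ^+ j / 2) ^+ 2 <= _); last first.
    by rewrite lerXn2r ?nnegrE// mulr_ge0// mulr_ge0// ltW.
  move: (2 ^+ j) (2 ^+ k) pj pk h2 => a b a0 b0 h2.
  have -> : (a * a / 2) ^+ 2 = a * a / 4 * a ^+ 2 by field.
  rewrite ler_wpM2r ?exprn_ge0 ?(ltW a0)// ler_pM2r ?invr_gt0//.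
  by rewrite ler_pM2l//; lra.
Qed.

(** Two powers of decay against [lacunary_gap] bound the j-th packet by a multiple of 2^-j 2^-k: the
    first factor is summed over j, the second is the error. *)
Lemma packet_sum_near phi z : schwartz phi -> exists2 C : R, 0 <= C &
  forall k, `|z| <= 4 ^+ k / 4 ->
  Normc.normc (stft phi (packet_sum zeta) (zeta k + z) -
    packet (zeta k) (2^-1 ^+ k)
      (modulation (zeta k + z).2 (translation (zeta k + z).1 phi))) <= C * 2^-1 ^+ k.
Proof.
move=> sphi; have [K K0 hK] := @packet_decay R d 2.
have [B hB] := schwartz_le_exists 2 sphi.
have B0 : 0 <= B.
  by apply: le_trans (hB 0%N [::] isT isT 0); rewrite expr0 mul1r normc_ge0.
exists (4 * (4 * (K * B))); first by rewrite !mulr_ge0.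
move=> k zk; rewrite -mulrA.
apply: (@csum_near _ (fun j => packet (zeta j) (2^-1 ^+ j)
  (modulation (zeta k + z).2 (translation (zeta k + z).1 phi)))).
  by rewrite !mulr_ge0// exprn_ge0// invr_ge0.
move=> j jk; set X := Normc.normc _.
have := hK phi B sphi hB (zeta k + z) (zeta j) _ (half_expr_itv j); rewrite -/X => hX.
have X0 : 0 <= X := normc_ge0 _.
have h := le_trans (ler_wpM2r X0 (lacunary_gap jk zk)) hX.
have pj : (0 : R) < 2 ^+ j by rewrite exprn_gt0.
have pk : (0 : R) < 2 ^+ k by rewrite exprn_gt0.
rewrite !exprVn -[leRHS]mulrA -invfM ler_pdivlMr ?mulr_gt0//.
by move: h; rewrite [2 ^+ k * _]mulrC mulrC; lra.
Qed.

End LowerBound.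

(** * The wave front set of the sum *)

Section WaveFrontSet.
Context {R : realType} {d : nat}.
Local Notation phase_space := ('rV[R]_d * 'rV[R]_d)%type.
Implicit Types (Gamma : set phase_space).

Lemma gabor_regular_zero (z0 : phase_space) : z0 <> 0 ->
  gabor_regular (fun=> 0) z0.
Proof.
move=> z00.
have cone0 : conic (set0 : set phase_space) by [].
(* Applied to the empty set, the separation lemma merely supplies an open cone around z0. *)
have [Gam0 [oG G0z0 _]] := cone_separated closed0 (@sub0set _ _) cone0 z00 id.
exists cgaussian; split; [exact: schwartz_cgaussian|exact: cgaussian_neq0|].
exists Gam0; split=> // N; exists 0 => _ [z _ <-].
by rewrite /stft [X in _ * X]Normc.normc0 mulr0.
Qed.

Lemma packet_sum_regular Gamma (zeta : nat -> phase_space) z0 :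
  closed (Gamma : set (subspace [set~ 0])) -> Gamma `<=` [set~ 0] -> conic Gamma ->
  (forall k, Gamma (zeta k)) -> (forall k, `|zeta k| = 4 ^+ k) ->
  z0 <> 0 -> ~ Gamma z0 -> gabor_regular (packet_sum zeta) z0.
Proof.
move=> clG G0 cG Gz nz z00 nGz0.
have [Gam0 [oG G0z0 [c c0 sep]]] := cone_separated clG G0 cG z00 nGz0.
exists cgaussian; split; [exact: schwartz_cgaussian|exact: cgaussian_neq0|].
exists Gam0; split=> // N.
apply: (stft_packet_sum_rapid nz N c0) => [|z Gam0z|z k Gam0z].
- exact: schwartz_cgaussian.
- by case: oG => _ _; apply.
- exact: sep.
Qed.

Lemma packet_sum_singular Gamma (zeta : nat -> phase_space) z0 :
  (forall k, `|zeta k| = 4 ^+ k) ->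
  (forall Gamma0 z w n, open Gamma0 -> conic Gamma0 -> Gamma z -> Gamma0 z ->
     exists2 k, (n <= k)%N & Gamma0 (zeta k + w)) ->
  Gamma z0 -> ~ gabor_regular (packet_sum zeta) z0.
Proof.
move=> nz dense Gz0 [phi [sphi phi0 [Gam0 [[oG cG _] Gam0z0 bnd]]]].
have [y0 phiy0] : exists y0, phi y0 != 0.
  apply: contrapT => h; apply: phi0; apply/funext => y.
  by apply/eqP/negPn/negP => ny; apply: h; exists y.
set r := Normc.normc (phi y0).
have r0 : 0 < r.
  rewrite lt_neqAle normc_ge0 andbT eq_sym.
  by apply: contra phiy0 => /eqP/Normc.eq0_normc ->.
pose CW : R := 4 * @weight_mean R d.
have CW0 : 0 < CW by rewrite mulr_gt0// exprn_gt0// mulr_gt0// expR_gt0.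
(* The continuity error and the width error cost r/4 each, leaving r/2 for the k-th packet; the
   other packets cost r/8, leaving 3r/8. *)
have e0 : 0 < r / (4 * CW) by rewrite divr_gt0// mulr_gt0.
have dphi : cdifferentiable phi y0 by case: sphi => /(_ [::] y0).
have [M M0 hM] := wave_pairing_lower_bound e0 dphi (schwartz_cbounded sphi).
have [C C0 hC] := packet_sum_near nz (- y0, 0) sphi.
(* First order decay is already contradicted: the transform stays above 3r/8 while the bracket grows
   like 4^k. *)
have [D hD] := bnd 1%N.
have [n1 h1] := half_pow_near0 (4 * `|(- y0, 0 : 'rV[R]_d)|) (@ltr01 R).
have [n2 h2] := half_pow_near0 M e0.
have r8 : 0 < r / 8 by rewrite divr_gt0.
have [n3 h3] := half_pow_near0 C r8.
have [n4 h4] := half_pow_near0 D r8.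
have [k nk Gam0k] := dense Gam0 z0 (- y0, 0) (n1 + n2 + n3 + n4)%N oG cG Gz0 Gam0z0.
have nk1 : (n1 <= k)%N by rewrite (leq_trans _ nk)// -!addnA leq_addr.
have nk2 : (n2 <= k)%N by rewrite (leq_trans _ nk)// addnAC -!addnA addnCA leq_addr.
have nk3 : (n3 <= k)%N by rewrite (leq_trans _ nk)// addnAC leq_addl.
have nk4 : (n4 <= k)%N by rewrite (leq_trans _ nk)// leq_addl.
have {h1 nk1}h1 := h1 k nk1; have {h2 nk2}h2 := h2 k nk2.
have {h3 nk3}h3 := h3 k nk3; have {h4 nk4}h4 := h4 k nk4.
set t : R := 2^-1 ^+ k in h1 h2 h3 h4; set w : phase_space := (- y0, 0) in h1 hC Gam0k.
have p2 : (0 : R) < 2 ^+ k by rewrite exprn_gt0.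
have p21 : (1 : R) <= 2 ^+ k by rewrite exprn_ege1// ler1n.
have t2 : t * 2 ^+ k = 1 by rewrite -exprMn mulVf// expr1n.
have four : (4 : R) ^+ k = 2 ^+ k * 2 ^+ k by rewrite -exprMn; congr (_ ^+ _); ring.
have w4 : `|w| <= 4 ^+ k / 4.
  have : 4 * `|w| <= 2 ^+ k.
    by have := ler_wpM2r (ltW p2) h1; rewrite -mulrA t2 mulr1 mul1r.
  have : (2 : R) ^+ k <= 2 ^+ k * 2 ^+ k by rewrite -[leLHS]mulr1 ler_pM2l.
  by rewrite four; lra.
have := hC k w4; rewrite packet_modulation_translation.
(* The shift by (-y0, 0) leaves frequency difference 0 and position difference y0, the setting of
   the lower bound. *)
have -> : (zeta k).2 - (zeta k + w).2 = 0 by rewrite /= addr0 subrr.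
have -> : (zeta k).1 - (zeta k + w).1 = y0 by rewrite /= opprD opprK addrA subrr add0r.
rewrite scaler0 -/t; set th := - dotr _ _.
have t0 : 0 <= t by rewrite exprn_ge0// invr_ge0.
have := hM th t t0; rewrite -/r -/CW.
set P := wave_pairing _ _ _ _ _; set S := stft _ _ _ => hP hS.
have hP' : r / 2 <= Normc.normc P.
  apply: le_trans hP; have := ler_wpM2l (ltW CW0) h2.
  have -> : CW * (r / (4 * CW)) = r / 4 by field; rewrite gt_eqF.
  have -> : CW * (r / (4 * CW) + M * t) = r / 4 + CW * (M * t).
    by field; rewrite gt_eqF.
  by lra.
have hX : 3 * r / 8 <= Normc.normc S.
  have : Normc.normc P <= Normc.normc S + Normc.normc (S - P).
    by rewrite -(normcN (S - P)) -[P in leLHS](subKr S) le_normcD.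
  by lra.
have jb : 3 / 4 * 4 ^+ k <= jbracket2 (zeta k + w).
  apply: le_trans (norm_le_jbracket2 _).
  by have := ler_normB (zeta k + w) w; rewrite addrK nz; lra.
have hjS : jbracket2 (zeta k + w) * Normc.normc S <= D.
  by have := hD _ (ex_intro2 _ _ _ Gam0k erefl); rewrite expr1.
have jb0 : 0 <= 3 / 4 * 4 ^+ k :> R by rewrite mulr_ge0 ?exprn_ge0.
have r38 : 0 <= 3 * r / 8 by lra.
have hD' := le_trans (ler_pM jb0 r38 jb hX) hjS.
have : r / 8 * 2 ^+ k < D * t * 2 ^+ k.
  rewrite -(mulrA D) t2 mulr1 (lt_le_trans _ hD')// four.
  move: (2 ^+ k) p2 p21 => a a0 a1.
  have : r * a <= r * (a * a) by rewrite ler_pM2l// -[leLHS]mulr1 ler_pM2l.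
  have ra : 0 < r * a by exact: mulr_gt0.
  by lra.
by rewrite ltr_pM2r// ltNge h4.
Qed.

End WaveFrontSet.

Theorem theorem6p1 (R : realType) (d : nat)
    (Gamma : set ('rV[R]_d * 'rV[R]_d))
    (hGamma0 : Gamma `<=` [set~ 0])
    (hGamma_closed : closed (Gamma : set (subspace [set~ 0])))
    (hGamma_conic : conic Gamma) :
  exists u : ('rV[R]_d -> R[i]) -> R[i], tempered u /\ WF_G u = Gamma.
Proof.
(* An empty cone offers no centres; the zero distribution serves instead. *)
have [E|/set0P Gne] := eqVneq Gamma set0.
  exists (fun=> 0); split.
    split=> [a f g _ _|f e _ e0]; first by rewrite mulr0 addr0.
    exists 0%N, 1; split=> // g _ _.
    by rewrite subrr [X in X < _](Normc.normc0 R).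
  rewrite E; apply/seteqP; split=> z // [z0]; apply.
  exact: gabor_regular_zero.
have [zeta [Gz nz dense]] := lacunary_sequence hGamma0 hGamma_conic Gne.
exists (packet_sum zeta); split; first exact: packet_sum_tempered.
apply/seteqP; split=> z.
  by move=> [z0]; apply: contra_notP; exact: packet_sum_regular Gz nz z0.
by move=> Gammaz; split; [exact: hGamma0|exact: packet_sum_singular nz dense Gammaz].
Qed.
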